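(* With probability tending to $1$ as $n\to\infty$, the uniform attachment graph $G_{n,13}$ is Hamiltonian, i.e. contains a cycle passing through all of its $n$ vertices.
   Context: For positive integers $n,k$, the uniform attachment graph $G_{n,k}$ is the random graph on vertex set $[n]=\{1,\dots,n\}$ in which each vertex $j\in\{2,\dots,n\}$ makes $k$ choices uniformly and independently (with repetition allowed; choices of different vertices are also independent) from $\{1,\dots,j-1\}$ and is joined by an edge to each chosen vertex. Edge orientations and multiplicities are disregarded, so $G_{n,k}$ is a simple undirected graph. *)

(* Defs.v *)
From mathcomp Require Import all_boot all_order all_algebra.
From mathcomp Require Import all_classical all_reals all_analysis.

Set Implicit Arguments.
Unset Strict Implicit.
Unset Printing Implicit Defensive.

Import Order.TTheory GRing.Theory Num.Theory.
Local Open Scope ring_scope.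

(* A simple graph on a finite type is given by its adjacency relation.        *)
(* The bound on the size excludes the sequences of at most two vertices that  *)
(* path.cycle accepts and that are not cycles of a simple graph.              *)
Definition hamiltonian (V : finType) (e : rel V) : Prop :=
  exists s : seq V, [/\ ucycle e s, (3 <= size s)%N & forall v, v \in s].

(* Vertices are numbered from 0: v : 'I_n is the vertex v + 1 of {1, .., n}.  *)
(* Vertex 0 makes no choice, so the choosing vertices are the j.+1 for        *)
(* j : 'I_n.-1; the i-th choice c j i of vertex j.+1 lies in                  *)
(* {0, .., j} = 'I_j.+1, the set of all the vertices preceding j.+1.          *)
Definition choices (n k : nat) : finType :=
  {dffun forall j : 'I_n.-1, {ffun 'I_k -> 'I_j.+1}}.

Definition chosen n k (c : choices n k) (v u : 'I_n) : bool :=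
  [exists j : 'I_n.-1, (v == j.+1 :> nat) &&
    [exists i : 'I_k, u == c j i :> nat]].

Definition ua_graph n k (c : choices n k) : rel 'I_n :=
  fun u v => chosen c u v || chosen c v u.

Lemma ua_graph_sym n k (c : choices n k) : symmetric (ua_graph c).
Proof. by move=> u v; rewrite /ua_graph orbC. Qed.

Lemma ua_graph_irrefl n k (c : choices n k) : irreflexive (ua_graph c).
Proof.
move=> u; rewrite /ua_graph orbb /chosen.
case: existsP => // -[j /andP[/eqP uj /existsP[i /eqP ui]]].
by have := ltn_ord (c j i); rewrite -ui uj ltnn.
Qed.

(* The choices are independent, the i-th choice of vertex j.+1 being uniform  *)
(* among j.+1 vertices.                                                       *)
Definition choices_mass (R : realType) n k (c : choices n k) : R :=
  \prod_(j < n.-1) \prod_(i < k) (#|'I_j.+1|%:R)^-1.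

Definition ua_prob (R : realType) n k (E : rel 'I_n -> Prop) : R :=
  \sum_(c : choices n k | `[< E (ua_graph c) >]) choices_mass R c.

Lemma choices_mass_total (R : realType) n k :
  \sum_(c : choices n k) choices_mass R c = 1.
Proof.
rewrite sumr_const card_dep_ffun foldrE big_map big_enum /= -mulr_natl.
rewrite natr_prod -big_split /= big1 // => j _.
rewrite card_ffun !card_ord prodr_const card_ord natrX -exprMn.
by rewrite mulfV ?expr1n // pnatr_eq0.
Qed.

(* Main.v *)
Require Import Defs.
From mathcomp Require Import all_boot all_order all_algebra.
From mathcomp Require Import zify ring lra.
From mathcomp Require Import all_classical all_reals all_analysis.
Import Order.TTheory GRing.Theory Num.Theory.
Import numFieldNormedType.Exports.

(** Why the theorem is true.  One of the thirteen choices of every vertex is set aside;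
    the graph of the other twelve is built vertex by vertex, and the set-aside
    choices are used only at the very end.

    Expansion.  In the twelve-choice graph on [N] vertices, with probability
    [1 - O(1 / N ^ 2)] every set [A] of at most [N / 8] vertices has at least
    [2 * #|A|] neighbours outside [A] ([mean_not_expanding]).  This is a union bound
    over pairs [A \subset S] with [#|S| = 3 * #|A|] such that no edge joins [A] to
    the complement of [S]; such a pair has probability at most
    [(#|S| / N) ^ (12 * #|A|)] wherever the two sets sit in the order of arrival
    ([mean_allowed]).  The errors being summable in [N], expansion holds with
    probability close to [1] at all times after a large constant [M]
    ([mean_not_steady]).

    Many ends.  In an expander, Pósa's rotations ([posa]) show that more than an
    eighth of all the vertices are ends of longest paths, and that each of these
    ends is joined by longest paths to more than an eighth of the vertices
    ([card_ends]).

    Drift.  Let the deficit be the number of vertices that a longest path misses.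
    A new vertex increases it by at most one; if it picks an end [x] of a longest
    path, the path extends and the deficit does not increase; if it also picks an
    end joined to [x] by a longest path, it closes a cycle, which by connectivity
    opens into a longer path, and the deficit decreases.  With twelve choices the
    last case has probability above [0.45] and the first below [0.21], so
    [(3 / 2) ^ deficit] contracts on average and its mean remains bounded
    ([mean_new_vertex], [mean_steady_weight]).  Hence the deficit at time [n] is at
    most a constant [T] with probability close to [1].

    Sprinkling.  Given an expander of deficit at most [T], add the
    choices set aside.  If no Hamiltonian cycle appears, then after adding at most [T] of these
    edges the others are all useless, that is, none joins the two ends of a longest
    path ([exhaust_boosters]).  For a given set of added edges, a positive fraction
    of all pairs of vertices are joined by longest paths, so this has probability
    at most [exp (- n / 128)] ([mean_avoid_ends]), and there are only
    [(n ^ 2 + 1) ^ T] sets of edges to consider ([mean_sprinkle]). *)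

Set Implicit Arguments.
Unset Strict Implicit.
Unset Printing Implicit Defensive.

(** * Longest paths and rotations *)

Definition links (T : eqType) (s : seq T) : seq (T * T) := zip s (behead s).

Lemma links_cat (T : eqType) (s1 s2 : seq T) v :
  links (s1 ++ v :: s2) = links (rcons s1 v) ++ links (v :: s2).
Proof. by elim: s1 => [|a [|b s1] IHs] //; move: IHs; rewrite /links /= => ->. Qed.

Lemma links_sub_cons (T : eqType) (v : T) s : {subset links s <= links (v :: s)}.
Proof. by case: s => [|a s] // x sx; rewrite in_cons sx orbT. Qed.

Lemma linksP (T : eqType) (s : seq T) a b :
  reflect (exists s1 s2, s = s1 ++ a :: b :: s2) ((a, b) \in links s).
Proof.
apply: (iffP idP) => [|[s1 [s2 ->]]]; last first.
  by rewrite links_cat mem_cat inE eqxx orbT.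
elim: s => [|x [|y s] IHs] //.
rewrite [links _]/= inE => /predU1P[[-> ->]|]; first by exists [::], s.
by move=> /IHs[s1 [s2 ->]]; exists (x :: s1), s2.
Qed.

Lemma links_rev (T : eqType) (s : seq T) a b :
  (a, b) \in links s -> (b, a) \in links (rev s).
Proof.
move=> /linksP[s1 [s2 ->]]; apply/linksP; exists (rev s2), (rev s1).
by rewrite rev_cat !rev_cons -!cats1 -!catA.
Qed.

Lemma links_index (T : eqType) (s : seq T) a b : uniq s -> (a, b) \in links s ->
  [/\ a \in s, b \in s & index b s = (index a s).+1].
Proof.
move=> + /linksP[s1 [s2 sE]]; rewrite {1}sE cat_uniq => /and3P[_ /hasPn s1P].
rewrite /= inE negb_or => /andP[/andP[ab _] _].
have as1 : a \notin s1 by apply: s1P; rewrite mem_head.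
have bs1 : b \notin s1 by apply: s1P; rewrite !inE eqxx orbT.
rewrite sE !mem_cat !inE !eqxx !orbT; split => //.
by rewrite !index_cat (negPf as1) (negPf bs1) /= !eqxx (negPf ab) addn0 addn1.
Qed.

Lemma links_inj (T : eqType) (s : seq T) a b a' b' : uniq s ->
  (a, b) \in links s -> (a', b') \in links s -> (a == a') = (b == b').
Proof.
move=> us /(links_index us)[aS bS iab] /(links_index us)[aS' bS' iab'].
apply/eqP/eqP => [aE|bE].
  by rewrite -[b](nth_index b bS) iab aE -iab' nth_index.
have /eqP := iab; rewrite bE iab' eqSS => /eqP iE.
by rewrite -[a](nth_index a aS) -iE nth_index.
Qed.

Lemma link_after (T : eqType) (s : seq T) x a :
  a \in s -> a != last x s -> exists b, (a, b) \in links s.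
Proof.
case/splitPr=> s1 [|b s2]; first by rewrite last_cat /= eqxx.
by move=> _; exists b; apply/linksP; exists s1, s2.
Qed.

Lemma link_before (T : eqType) (s : seq T) x a :
  a \in s -> a != head x s -> exists b, (b, a) \in links s.
Proof.
case/splitPr=> s1; case/lastP: s1 => [|s1 b] s2; first by rewrite /= eqxx.
by move=> _; exists b; apply/linksP; exists s1, s2; rewrite cat_rcons.
Qed.

Definition upath (T : eqType) (e : rel T) (s : seq T) := uniq s && sorted e s.

Definition longest (T : finType) (e : rel T) : nat :=
  \max_(k < #|T|.+1 | [exists t : k.-tuple T, upath e t]) k.

Lemma leq_longest (T : finType) (e : rel T) s : upath e s -> size s <= longest e.
Proof.
move=> es; have /andP[us _] := es; have sT := uniq_leq_size us (fun x _ => mem_enum T x).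
rewrite -cardE -ltnS in sT.
apply: (@leq_bigmax_cond _ _ (fun k : 'I_#|T|.+1 => nat_of_ord k) (Ordinal sT)).
by apply/existsP; exists (in_tuple s).
Qed.

Lemma longest_ex (T : finType) (e : rel T) :
  exists2 s, upath e s & size s = longest e.
Proof.
pose P := [pred k : 'I_#|T|.+1 | [exists t : k.-tuple T, upath e t]].
have P0 : P ord0 by apply/existsP; exists [tuple].
have [] := @eq_bigmax_cond _ P (fun k => val k); first by apply/card_gt0P; exists ord0.
by move=> k /existsP[t et] kE; exists t => //; rewrite size_tuple -kE.
Qed.

Lemma longest_le (T : finType) (e : rel T) : longest e <= #|T|.
Proof. by apply/bigmax_leqP => k _; rewrite -ltnS. Qed.

Lemma longest_sub (T : finType) (e e' : rel T) : subrel e e' ->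
  longest e <= longest e'.
Proof.
move=> ee'; have [s /andP[us es] <-] := longest_ex e.
by apply: leq_longest; rewrite /upath us (sub_sorted ee').
Qed.

Definition ends (T : finType) (e : rel T) (x y : T) :=
  [exists t : (longest e).-tuple T,
    [&& upath e t, ohead t == Some x & last x t == y]].

Lemma endsP (T : finType) (e : rel T) x y :
  reflect (exists p, [/\ upath e (x :: p), (size p).+1 = longest e & last x p = y])
    (ends e x y).
Proof.
apply: (iffP existsP) => [[[[|z p] sp] /=]|[p [ep sp lp]]].
  by [].
  by move=> /and3P[ep /eqP[<-] /eqP yE]; exists p; split => //; apply/eqP.
have sp' : size (x :: p) == longest e by exact/eqP.
by exists (Tuple sp') => /=; rewrite ep eqxx lp eqxx.
Qed.

Lemma upath_rev (T : eqType) (e : rel T) s : symmetric e -> upath e (rev s) = upath e s.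
Proof.
move=> sym; rewrite /upath rev_uniq rev_sorted; congr (_ && _).
by apply: eq_sorted => x y; rewrite sym.
Qed.

Lemma ends_sym (T : finType) (e : rel T) : symmetric e -> symmetric (ends e).
Proof.
move=> sym; suff E x y : ends e x y -> ends e y x by move=> x y; apply/idP/idP; apply: E.
move=> /endsP[p [ep sp lp]].
have E : rev (x :: p) = y :: rev (belast x p) by rewrite lastI rev_rcons lp.
apply/endsP; exists (rev (belast x p)); rewrite -E upath_rev // size_rev size_belast.
by split => //; case: p {ep sp E} lp => [|z p] //= _; rewrite rev_cons last_rcons.
Qed.

Lemma ends_neq (T : finType) (e : rel T) x y : 1 < longest e -> ends e x y -> x != y.
Proof.
move=> L1 /endsP[p [/andP[/andP[xp _] _] sp <-]]; case: p xp sp => [|z p] xp sp.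
  by rewrite -sp in L1.
by apply: contraNneq xp => xE; rewrite {1}xE; apply: (mem_last z p).
Qed.

Definition nbhd (T : finType) (e : rel T) (U : {set T}) : {set T} :=
  [set v | (v \notin U) && [exists u in U, e u v]].

Inductive rotated (T : eqType) (e : rel T) (s : seq T) : seq T -> Prop :=
| Rot0 : rotated e s s
| RotS t1 v w t2 : rotated e s (t1 ++ v :: w :: t2) -> e v (last w t2) ->
    rotated e s (t1 ++ v :: rev (w :: t2)).

Lemma rotated_path (T : eqType) (e : rel T) x p t : symmetric e ->
  path e x p -> rotated e (x :: p) t ->
  [/\ perm_eq t (x :: p), sorted e t & head x t = x].
Proof.
move=> sym ep; elim=> {t} // t1 v w t2 _ [pt et ht] ev; split.
- apply: perm_trans pt; by rewrite perm_cat2l perm_cons perm_rev.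
- move: et; have E : sorted e (v :: w :: t2) -> path e v (rev (w :: t2)).
    have revE : rev (w :: t2) = last w t2 :: rev (belast w t2).
      by rewrite lastI rev_rcons.
    move=> /= /andP[_ ewt]; rewrite revE /= ev -[path _ _ _]/(sorted e (_ :: _)).
    by rewrite -revE rev_sorted (eq_sorted (e' := e)) // => a b; rewrite sym.
  by case: t1 {pt ht} => [|a t1] //=; rewrite !cat_path => /andP[-> /=] /andP[-> /=].
- by move: ht; case: t1 {pt et}.
Qed.

(** Reversing the part of the path after [v] destroys a single link. *)
Lemma links_rotated (T : eqType) (t1 t2 : seq T) v w a b :
  (a, b) \in links (t1 ++ v :: w :: t2) ->
  [\/ (a, b) = (v, w), (a, b) \in links (t1 ++ v :: rev (w :: t2))
    | (b, a) \in links (t1 ++ v :: rev (w :: t2))].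
Proof.
rewrite !links_cat !mem_cat [links (v :: w :: t2)]/= inE => /or3P[-> | /eqP | ab].
- exact: Or32.
- exact: Or31.
- by apply: Or33; rewrite links_sub_cons ?orbT // links_rev.
Qed.

(** Pósa's lemma.  [U] is the set of endpoints obtained from a longest path by
    rotations that fix the endpoint [x].  A rotation destroys one link [(v, w)] of
    the path and makes [w] an endpoint; so if neither [v] nor its neighbours along
    the original path are in [U], the links at [v] never change.  An edge from
    an endpoint in [U] to such a [v] would however allow a rotation turning one of
    these neighbours into an endpoint.  Hence every neighbour of [U] is next to an
    element of [U] along the original path. *)
Lemma posa (T : finType) (e : rel T) x y : symmetric e -> ends e x y ->
  exists U : {set T}, [/\ {in U, forall z, ends e x z}, U != finset.set0 & #|nbhd e U| < 2 * #|U|].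
Proof.
move=> sym /endsP[p [/andP[us ep] sp lp]]; set s := x :: p in us ep.
have rot_path t := @rotated_path _ e x p t sym ep.
have us_rot t : rotated e s t -> uniq t.
  by move=> /rot_path[pt _ _]; rewrite (perm_uniq pt).
pose U := [set y | `[< exists2 t, rotated e s t & last x t = y >]].
have inU t : rotated e s t -> last x t \in U.
  by move=> rt; rewrite inE; apply/asboolP; exists t.
(* A rotation destroys one link, and one end of that link enters [U]. *)
have persist t a b : rotated e s t -> a \notin U -> b \notin U ->
    (a, b) \in links s -> ((a, b) \in links t) || ((b, a) \in links t).
  move=> rt aU bU ab; elim: rt => [|t1 v w t2 rt IHt ev]; first by rewrite ab.
  have wU : w \in U.
    by have := inU _ (RotS rt ev); rewrite rev_cons -rcons_cons -rcons_cat last_rcons.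
  have Nw c d : c \notin U -> d \notin U -> (c, d) <> (v, w).
    by move=> cU dU [cv dw]; rewrite dw wU in dU.
  have Nw1 := Nw _ _ aU bU; have Nw2 := Nw _ _ bU aU.
  by case/orP: IHt => /links_rotated[]//->; rewrite ?orbT.
have NU v : v \in nbhd e U ->
    exists2 z, z \in U & ((v, z) \in links s) || ((z, v) \in links s).
  rewrite inE => /andP[vU /exists_inP[u]]; rewrite inE => /asboolP[t rt tu] euv.
  have [pt et ht] := rot_path _ rt.
  have vt : v \in t.
    apply: contraT => vt; suff /leq_longest : upath e (rcons t v).
      by rewrite size_rcons (perm_size pt) /= sp ltnn.
    rewrite /upath rcons_uniq vt us_rot //=.
    case: t {rt pt vt} et ht tu => [|a t] // et ht /= tu.
    by rewrite /= in et tu *; rewrite rcons_path et tu.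
  have vs : v \in s by rewrite -(perm_mem pt).
  have vl : v != last x s by apply: contraNneq vU => ->; apply/inU/Rot0.
  have [w vw] : exists w, (v, w) \in links t.
    by apply: (link_after (x := x)) => //; apply: contraNneq vU => ->; apply: inU.
  have wU : w \in U.
    have /linksP[t1 [t2 tE]] := vw; rewrite tE in rt tu.
    rewrite last_cat /= in tu.
    have ev : e v (last w t2) by rewrite tu sym.
    by have := inU _ (RotS rt ev); rewrite rev_cons -rcons_cons -rcons_cat last_rcons.
  (* Otherwise both links at [v] in the original path are still in [t], and one of
     them is [(v, w)]. *)
  have [v1 v1s] := link_after vs vl; have [v1U|v1U] := boolP (v1 \in U).
    by exists v1; rewrite ?v1s.
  have v1t : (v1, v) \in links t.
    have /orP[v1t|//] := persist _ _ _ rt vU v1U v1s.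
    have := links_inj (us_rot _ rt) vw v1t; rewrite eqxx => /esym/eqP wE.
    by rewrite -wE wU in v1U.
  have vh : v != head x s.
    apply/eqP => vx; have [_ _] := links_index (us_rot _ rt) v1t.
    by rewrite vx /= -[in index x t]ht; case: (t) => //= a l; rewrite eqxx.
  have [v0 v0s] := link_before vs vh; have [v0U|v0U] := boolP (v0 \in U).
    by exists v0; rewrite ?v0s ?orbT.
  have /orP[v0t|v0t] := persist _ _ _ rt v0U vU v0s; last first.
    have := links_inj (us_rot _ rt) vw v0t; rewrite eqxx => /esym/eqP wE.
    by rewrite -wE wU in v0U.
  have := links_inj (us_rot _ rt) v1t v0t; rewrite eqxx => /eqP v10.
  rewrite v10 in v1s; have [_ _ i1] := links_index us v1s.
  have [_ _ i0] := links_index us v0s.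
  by have := leqnn (index v s); rewrite {1}i0 i1 -ltnS ltnNge leqnSn.
exists U; split.
- move=> z; rewrite inE => /asboolP[t rt <-].
  have [pt et ht] := rot_path _ rt; have ut := us_rot _ rt.
  apply/endsP; case: t {rt} pt et ht ut => [/perm_size//|a t] pt et /= ht ut; subst a.
  by exists t; split; [apply/andP | rewrite -sp; apply: (perm_size pt) |].
- by apply/finset.set0Pn; exists (last x s); apply/inU/Rot0.
(* The last vertex is in [U] and has no successor, whence the strict inequality. *)
pose pr z := nth z s (index z s).-1; pose nx z := nth z s (index z s).+1.
have ls : last x s \in U by apply/inU/Rot0.
have sub : nbhd e U \subset (pr @: U) :|: (nx @: (U :\ last x s)).
  apply/fintype.subsetP => v /NU[z zU /orP[vz|zv]]; apply/finset.setUP; [left|right].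
    apply/imsetP; exists z => //; have [vs _ iz] := links_index us vz.
    by rewrite /pr iz nth_index.
  have [zs vs iz] := links_index us zv.
  apply/imsetP; exists z; last by rewrite /nx -iz nth_index.
  rewrite finset.in_setD1 zU andbT; apply/eqP => zE.
  move: vs; rewrite -index_mem iz zE -[last x s]/(last x p) (index_last us).
  by rewrite ltnn.
apply: leq_ltn_trans (subset_leq_card sub) _.
apply: leq_ltn_trans (leq_card_setU _ _) _.
have := leq_imset_card pr U; have := leq_imset_card nx (U :\ last x s).
have := cardsD1 (last x s) U; rewrite ls => E; rewrite E; lia.
Qed.

(** * Longest paths in expanders *)

(** The threshold [#|V| / 8] is low enough for a first-moment bound with twelve
    choices, and high enough for the longest path to gain on the growing graph. *)
Definition expanding (T : finType) (e : rel T) (V : {set T}) :=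
  forall A : {set T}, A \subset V -> A != finset.set0 -> 8 * #|A| <= #|V| ->
    2 * #|A| <= #|nbhd e A|.

Definition connected_on (T : finType) (e : rel T) (V : {set T}) :=
  forall A : {set T}, A \subset V -> A != finset.set0 -> A != V ->
    exists a b, [/\ a \in A, b \in V :\: A & e a b].

Definition edges_in (T : finType) (e : rel T) (V : {set T}) :=
  forall u v, e u v -> u \in V.

Lemma upath_in (T : finType) (e : rel T) (V : {set T}) s : symmetric e ->
  edges_in e V -> upath e s -> 1 < size s -> {subset s <= V}.
Proof.
move=> sym eV /andP[_ es]; case: s es => [|x [|y s]] // /= /andP[exy es] _ z.
rewrite inE => /predU1P[->|]; first exact: eV exy.
have: y \in V by apply: eV; rewrite sym in exy; exact: exy.
elim: s y {x exy} es => [|x s IHs] y /=; first by move=> _ yV; rewrite inE => /eqP ->.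
move=> /andP[eyx es] yV; rewrite inE => /predU1P[-> //|].
by apply: IHs es _; apply: eV; rewrite sym in eyx; exact: eyx.
Qed.

Lemma ends_in (T : finType) (e : rel T) (V : {set T}) x y : symmetric e ->
  edges_in e V -> 1 < longest e -> ends e x y -> y \in V.
Proof.
move=> sym eV L1 /endsP[p [ep sp <-]].
by apply: (upath_in sym eV ep); rewrite /= ?sp ?mem_last.
Qed.

(** The set of ends given by Pósa's lemma does not expand, so it is too large for the
    hypothesis of expansion to apply. *)
Lemma card_ends (T : finType) (e : rel T) (V : {set T}) x y : symmetric e ->
  edges_in e V -> expanding e V -> 1 < longest e -> ends e x y ->
  #|V| < 8 * #|[set z | ends e x z]|.
Proof.
move=> sym eV exV L1 xy; have [U [Ux U0 Us]] := posa sym xy.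
have UE : #|U| <= #|[set z | ends e x z]|.
  by apply/subset_leq_card/fintype.subsetP => z /Ux; rewrite inE.
apply: leq_trans (_ : 8 * #|U| <= _); last by rewrite leq_mul2l.
rewrite ltnNge; apply/negP => UV; have := exV U _ U0 UV; rewrite leqNgt Us => H.
by suff /H : U \subset V by []; apply/fintype.subsetP => z /Ux; exact: ends_in.
Qed.

Lemma cycle_extend (T : eqType) (e : rel T) t a b : symmetric e ->
  ucycle e t -> a \in t -> b \notin t -> e a b ->
  exists2 s, upath e s & size s = (size t).+1.
Proof.
move=> sym /andP[et ut] at_ bt eab; have [i t' tE] := rot_to at_.
exists (b :: a :: t'); last by rewrite -tE /= size_rot.
rewrite -(rot_cycle i) tE /= rcons_path in et; case/andP: et => et _.
by rewrite /upath -tE cons_uniq mem_rot bt rot_uniq ut tE /= sym eab.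
Qed.

Lemma upath_cycle (T : eqType) (e : rel T) x p :
  upath e (x :: p) -> e (last x p) x -> ucycle e (x :: p).
Proof. by move=> /andP[up ep] exp; rewrite /ucycle /= rcons_path [path _ _ _]ep exp. Qed.

Lemma upath_sub (T : eqType) (e e' : rel T) s : subrel e e' -> upath e s -> upath e' s.
Proof. by move=> ee' /andP[us es]; rewrite /upath us (sub_sorted ee'). Qed.

(** A cycle missing some vertex of a connected graph can be opened next to an
    edge that leaves it. *)
Lemma cycle_grow (T : finType) (e e' : rel T) (V : {set T}) t x : symmetric e' ->
  subrel e e' -> connected_on e V -> ucycle e' t -> x \in t -> x \in V ->
  ~~ (V \subset t) -> size t < longest e'.
Proof.
move=> sym ee' conV ct xt xV Vt; pose A := [set v in V | v \in t].
have AV : A \subset V by apply/fintype.subsetP => v; rewrite inE => /andP[].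
have A0 : A != finset.set0 by apply/finset.set0Pn; exists x; rewrite inE xV.
have AnV : A != V.
  apply: contraNneq Vt => <-; apply/fintype.subsetP => v; by rewrite inE => /andP[].
have [a [b [aA bA eab]]] := conV A AV A0 AnV.
have at_ : a \in t by move: aA; rewrite inE => /andP[].
have bt : b \notin t by move: bA; rewrite !inE => /andP[+ bV]; rewrite bV.
have [s es sE] := cycle_extend sym ct at_ bt (ee' _ _ eab).
by rewrite -sE; exact: leq_longest.
Qed.

(** The added edge closes a cycle, which either spans the graph or can be opened
    into a longer path. *)
Lemma booster (T : finType) (e e' : rel T) x y : symmetric e' -> subrel e e' ->
  connected_on e [set: T] -> 2 < longest e -> ends e x y -> e' x y ->
  hamiltonian e' \/ longest e < longest e'.
Proof.
move=> sym ee' con L2 /endsP[p [ep sp lp]] exy.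
have ct : ucycle e' (x :: p).
  by apply: upath_cycle; [exact: upath_sub ee' ep | rewrite lp sym].
have [all_p|not_p] := boolP ([set: T] \subset x :: p).
  left; exists (x :: p); split => //; first by rewrite /= sp.
  by move=> v; apply: (fintype.subsetP all_p); rewrite inE.
right; rewrite -sp; apply: cycle_grow con ct _ _ not_p => //; first exact: mem_head.
by rewrite inE.
Qed.

Lemma new_vertex_path (T : finType) (e e' : rel T) (V : {set T}) w x y :
  symmetric e -> edges_in e V -> subrel e e' -> w \notin V -> 1 < longest e ->
  ends e x y -> e' w x -> longest e < longest e'.
Proof.
move=> sym eV ee' wV L1 /endsP[p [ep sp lp]] ewx; rewrite -sp.
have pV : {subset x :: p <= V} by apply: upath_in ep _; rewrite //= sp.
suff: upath e' (w :: x :: p) by move/leq_longest.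
have /andP[up /= pp] := upath_sub ee' ep.
by rewrite /upath cons_uniq up /= ewx pp !andbT; apply: contra wV; apply: pV.
Qed.

(** The path and [w] form a cycle, which is opened towards a vertex missed by the
    path: the gain is two, one more than the growth of the graph. *)
Lemma new_vertex_cycle (T : finType) (e e' : rel T) (V : {set T}) w x y :
  symmetric e -> symmetric e' -> edges_in e V -> connected_on e V -> subrel e e' ->
  w \notin V -> 1 < longest e < #|V| -> ends e x y -> e' w x -> e' w y ->
  (longest e).+1 < longest e'.
Proof.
move=> sym sym' eV con ee' wV /andP[L1 LV] /endsP[p [ep sp lp]] ewx ewy.
have pV : {subset x :: p <= V} by apply: upath_in ep _; rewrite //= sp.
have wp : w \notin x :: p by apply: contra wV; apply: pV.
have ct : ucycle e' (w :: x :: p).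
  apply: upath_cycle; last by rewrite /= lp sym'.
  have /andP[up /= pp] := upath_sub ee' ep.
  by rewrite /upath cons_uniq wp up /= ewx pp.
rewrite -sp; apply: (cycle_grow (x := x) sym' ee' con ct).
- by rewrite !inE eqxx orbT.
- exact/pV/mem_head.
apply: contraTN LV => VS; rewrite -leqNgt -sp.
have <- : #|x :: p| = (size p).+1 by apply/card_uniqP; case/andP: ep.
apply/subset_leq_card/fintype.subsetP => v vV.
move/fintype.subsetP/(_ v vV): VS; rewrite inE => /predU1P[vw|//].
by rewrite -vw vV in wV.
Qed.

(** * Uniform averages over attachment histories *)

(** All the probabilities are averages over explicit lists of equally likely
    outcomes; these lists are built in the order of arrival of the vertices, which
    turns conditioning on the past into nested averages. *)

Section Mean.
Local Open Scope ring_scope.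
Variable R : realType.

Definition mean (X : Type) (s : seq X) (F : X -> R) : R :=
  (\sum_(x <- s) F x) / (size s)%:R.

Lemma mean_allpairs (X Y Z : Type) (f : X -> Y -> Z) s t F :
  mean [seq f x y | x <- s, y <- t] F = mean s (fun x => mean t (fun y => F (f x y))).
Proof.
rewrite /mean big_allpairs_dep size_allpairs natrM invfM mulrA mulrAC.
by rewrite mulr_suml.
Qed.

Lemma eq_mean (X : eqType) (s : seq X) F G : {in s, F =1 G} -> mean s F = mean s G.
Proof. by move=> FG; rewrite /mean (eq_big_seq _ FG). Qed.

Lemma ler_mean (X : eqType) (s : seq X) F G :
  {in s, forall x, F x <= G x} -> mean s F <= mean s G.
Proof.
move=> FG; rewrite ler_wpM2r ?invr_ge0 ?ler0n // big_seq [leRHS]big_seq.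
exact: ler_sum.
Qed.

Lemma mean_cst (X : Type) (s : seq X) (a : R) : (0 < size s)%N ->
  mean s (fun=> a) = a.
Proof.
move=> s0; rewrite /mean big_const_seq count_predT iter_addr_0 -[a *+ _]mulr_natr mulfK //.
by rewrite pnatr_eq0 -lt0n.
Qed.

Lemma mean_ge0 (X : eqType) (s : seq X) F : {in s, forall x, 0 <= F x} -> 0 <= mean s F.
Proof. by move=> F0; rewrite divr_ge0 ?ler0n // big_seq; exact: sumr_ge0. Qed.

Lemma meanZl (X : Type) (s : seq X) a F : mean s (fun x => a * F x) = a * mean s F.
Proof. by rewrite /mean -mulr_sumr mulrA. Qed.

Lemma meanZr (X : Type) (s : seq X) a F : mean s (fun x => F x * a) = mean s F * a.
Proof. by rewrite /mean -mulr_suml mulrAC. Qed.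

Lemma meanD (X : Type) (s : seq X) F G :
  mean s (fun x => F x + G x) = mean s F + mean s G.
Proof. by rewrite /mean big_split mulrDl. Qed.

Lemma meanB (X : Type) (s : seq X) F G :
  mean s (fun x => F x - G x) = mean s F - mean s G.
Proof. by rewrite /mean sumrB mulrBl. Qed.

Lemma mean_sum (X I : Type) (s : seq X) (r : seq I) P (F : X -> I -> R) :
  mean s (fun x => \sum_(i <- r | P i) F x i) = \sum_(i <- r | P i) mean s (F^~ i).
Proof. by rewrite /mean exchange_big mulr_suml. Qed.

Lemma exchange_mean (X Y : Type) (s : seq X) (t : seq Y) (F : X -> Y -> R) :
  mean s (fun x => mean t (F x)) = mean t (fun y => mean s (F^~ y)).
Proof.
rewrite /mean -!mulr_suml exchange_big -!mulrA; congr (_ * _).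
by rewrite mulrC.
Qed.

Lemma mean_count (X : Type) (s : seq X) (p : pred X) :
  mean s (fun x => (p x)%:R) = (count p s)%:R / (size s)%:R.
Proof.
rewrite /mean; congr (_ / _); elim: s => [|x s IHs]; first by rewrite big_nil.
by rewrite big_cons IHs /= natrD.
Qed.

(** Vertex [0] chooses nothing: the entry of index [j] of a history belongs to the
    vertex [j.+1], which chooses among [j.+1] vertices. *)
Fixpoint words k m : seq (seq nat) :=
  if k is k'.+1 then [seq x :: l | x <- iota 0 m, l <- words k' m] else [:: [::]].

Fixpoint hists k m : seq (seq (seq nat)) :=
  if m is m'.+1 then [seq rcons h l | h <- hists k m', l <- words k m]
  else [:: [::]].

Lemma mean_words k m F : mean (words k.+1 m) F =
  mean (iota 0 m) (fun x => mean (words k m) (fun l => F (x :: l))).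
Proof. exact: mean_allpairs. Qed.

Lemma mean_words1 m F : mean (words 1 m) F = mean (iota 0 m) (fun x => F [:: x]).
Proof.
rewrite mean_words; apply: eq_mean => x _.
by rewrite /mean big_cons big_nil addr0 divr1.
Qed.

Lemma mean_hists k m F : mean (hists k m.+1) F =
  mean (hists k m) (fun h => mean (words k m.+1) (fun l => F (rcons h l))).
Proof. exact: mean_allpairs. Qed.

Lemma size_words k m : size (words k m) = (m ^ k)%N.
Proof. by elim: k => //= k IHk; rewrite size_allpairs size_iota IHk expnS. Qed.

Lemma size_hists k m : size (hists k m) = (\prod_(j < m) j.+1 ^ k)%N.
Proof.
elim: m => [|m IHm]; first by rewrite big_ord0.
by rewrite big_ord_recr -IHm -(size_words k m.+1) [LHS]size_allpairs.
Qed.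

Lemma words_gt0 k m : (0 < size (words k m.+1))%N.
Proof. by rewrite size_words expn_gt0. Qed.

Lemma hists_gt0 k m : (0 < size (hists k m))%N.
Proof. by rewrite size_hists; apply: prodn_gt0 => j; rewrite expn_gt0. Qed.

Lemma mem_words k m l :
  (l \in words k m) = (size l == k) && all (fun x => (x < m)%N) l.
Proof.
elim: k l => [|k IHk] [|x l] //=.
  by apply/negbTE/allpairsP => -[[y l'] [_ _]].
rewrite eqSS; transitivity ((x < m)%N && (l \in words k m)).
  apply/allpairsP/andP => [[[y l'] /= [+ l'P [-> ->]]]|[xm lP]].
    by rewrite mem_iota.
  by exists (x, l); rewrite /= mem_iota.
by rewrite IHk andbCA.
Qed.

Lemma mem_hists k m h : reflect
  (size h = m /\ forall j, (j < m)%N -> nth [::] h j \in words k j.+1)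
  (h \in hists k m).
Proof.
elim: m h => [|m IHm] h.
  by apply: (iffP idP) => [|[/size0nil->]] //; rewrite inE => /eqP->.
apply: (iffP allpairsP) => [[[g l] /= [/IHm[gm gP] lP ->]]|[hm hP]].
  rewrite size_rcons gm; split=> // j; rewrite ltnS nth_rcons gm => jm.
  by case: ltngtP jm => // [/gP//|->].
case/lastP: h => // g l in hm hP *; move: hm; rewrite size_rcons => -[gm].
exists (g, l); split => //=; last by have := hP m (ltnSn m); rewrite nth_rcons gm ltnn eqxx.
apply/IHm; split => // j jm; have := hP j (ltnW jm); by rewrite nth_rcons gm jm.
Qed.

Lemma mean_words_all k m (p : pred nat) :
  mean (words k m) (fun l => (all p l)%:R) = ((count p (iota 0 m))%:R / m%:R) ^+ k.
Proof.
elim: k => [|k IHk]; first by rewrite /mean big_cons big_nil addr0 divr1 expr0.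
rewrite mean_words exprS -IHk -[in m%:R](size_iota 0 m) -mean_count -meanZr.
by apply: eq_mean => x _; rewrite -meanZl; apply: eq_mean => l _ /=; rewrite -natrM mulnb.
Qed.

(** The product events, whose probability is an explicit product. *)
Definition follows (p : nat -> pred nat) (h : seq (seq nat)) :=
  all (fun j => all (p j.+1) (nth [::] h j)) (iota 0 (size h)).

Lemma follows_rcons p h l :
  follows p (rcons h l) = follows p h && all (p (size h).+1) l.
Proof.
rewrite /follows size_rcons -addn1 iotaD all_cat /= andbT add0n nth_rcons ltnn eqxx.
congr (_ && _); last by rewrite addn1.
apply: eq_in_all => j; rewrite mem_iota => /andP[_ jh].
by rewrite nth_rcons jh.
Qed.

Lemma mean_follows k m p : mean (hists k m) (fun h => (follows p h)%:R) =
  \prod_(j < m) ((count (p j.+1) (iota 0 j.+1))%:R / j.+1%:R) ^+ k.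
Proof.
elim: m => [|m IHm].
  by rewrite /mean big_ord0 big_cons big_nil addr0 divr1.
rewrite mean_hists big_ord_recr /= -IHm -meanZr; apply: eq_mean => h /mem_hists[hm _].
rewrite -[_ ^+ k](mean_words_all k m.+1 (p m.+1)) -meanZl; apply: eq_mean => l _.
by rewrite follows_rcons hm -natrM mulnb.
Qed.

Definition merge_hist (g h : seq (seq nat)) := [seq p.1 ++ p.2 | p <- zip g h].

Lemma merge_hist_rcons g h x l : size g = size h ->
  merge_hist (rcons g x) (rcons h l) = rcons (merge_hist g h) (x ++ l).
Proof. by move=> gh; rewrite /merge_hist zip_rcons // map_rcons. Qed.

(** The first choice of each vertex is independent of the others. *)
Lemma mean_merge k m F : mean (hists k.+1 m) F =
  mean (hists k m) (fun h => mean (hists 1 m) (fun g => F (merge_hist g h))).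
Proof.
elim: m F => [|m IHm] F; first by rewrite /mean !(big_cons, big_nil) !addr0 !divr1.
rewrite !mean_hists IHm; apply: eq_mean => h /mem_hists[hm _].
transitivity (mean (hists 1 m) (fun g => mean (words k m.+1) (fun l =>
    mean (words 1 m.+1) (fun x => F (merge_hist (rcons g x) (rcons h l)))))).
  apply: eq_mean => g /mem_hists[gm _]; rewrite mean_words exchange_mean.
  apply: eq_mean => l _; rewrite mean_words1; apply: eq_mean => x _.
  by rewrite merge_hist_rcons ?gm.
by rewrite exchange_mean; apply: eq_mean => l _; rewrite mean_hists.
Qed.

End Mean.

Arguments words : simpl never.
Arguments hists : simpl never.

(** * The graph of a history *)

Definition picks (h : seq (seq nat)) (v u : nat) := u \in nth [::] ([::] :: h) v.

Definition hist_graph n (h : seq (seq nat)) : rel 'I_n :=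
  fun u v => picks h u v || picks h v u.

Lemma hist_graph_sym n h : symmetric (@hist_graph n h).
Proof. by move=> u v; rewrite /hist_graph orbC. Qed.

Definition choices_hist n k (c : choices n k) : seq (seq nat) :=
  [seq [seq nat_of_ord (c j i) | i <- enum 'I_k] | j <- enum 'I_n.-1].

Lemma nth_choices_hist n k (c : choices n k) (j : 'I_n.-1) :
  nth [::] (choices_hist c) j = [seq nat_of_ord (c j i) | i <- enum 'I_k].
Proof. by rewrite (nth_map j) ?size_enum_ord // nth_ord_enum. Qed.

Lemma choices_hist_in n k (c : choices n k) : choices_hist c \in hists k n.-1.
Proof.
apply/mem_hists; split=> [|j jn]; first by rewrite size_map size_enum_ord.
rewrite (nth_choices_hist c (Ordinal jn)) mem_words size_map size_enum_ord eqxx.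
by apply/allP => x /mapP[i _ ->]; exact: ltn_ord.
Qed.

Lemma choices_hist_inj n k : injective (@choices_hist n k).
Proof.
move=> c c' E; apply/ffunP => j; apply/ffunP => i; apply: val_inj.
have := nth_choices_hist c j; rewrite E nth_choices_hist => /eq_in_map/(_ i).
by rewrite mem_enum => /(_ isT)/esym.
Qed.

Lemma ua_graphE n k (c : choices n k) : ua_graph c = hist_graph (choices_hist c).
Proof.
suff E (v u : 'I_n) : chosen c v u = picks (choices_hist c) v u.
  by apply/funext => u; apply/funext => v; rewrite /ua_graph !E.
apply/existsP/idP => [[j /andP[/eqP vj /existsP[i /eqP ui]]]|].
  rewrite /picks vj /= nth_choices_hist ui; apply: map_f; exact: mem_enum.
rewrite /picks; case: v => -[//|j] jn /=.
have jn' : j < n.-1 by lia.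
rewrite (nth_choices_hist c (Ordinal jn')) => /mapP[i _ ui].
by exists (Ordinal jn'); rewrite eqxx; apply/existsP; exists i; apply/eqP.
Qed.

(** All choice functions have the same mass, and coding them as histories is a
    bijection: it is injective and the numbers agree. *)
Lemma ua_probE (R : realType) n k (E : rel 'I_n -> Prop) :
  (ua_prob R k E = mean (hists k n.-1) (fun h => (`[< E (hist_graph h) >])%:R))%R.
Proof.
have perm : perm_eq (map (@choices_hist n k) (enum (choices n k))) (hists k n.-1).
  have um : uniq (map (@choices_hist n k) (enum (choices n k))).
    by rewrite map_inj_uniq ?enum_uniq //; exact: choices_hist_inj.
  have sub : {subset map (@choices_hist n k) (enum (choices n k)) <= hists k n.-1}.
    by move=> h /mapP[c _ ->]; exact: choices_hist_in.
  have sz : size (hists k n.-1) = #|choices n k|.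
    rewrite size_hists card_dep_ffun foldrE big_map big_enum /=.
    by apply: eq_bigr => j _; rewrite card_ffun !card_ord.
  have [] := uniq_min_size um sub; first by rewrite size_map -cardE sz.
  by move=> _ mem; apply: uniq_perm => //; rewrite -(eq_uniq _ mem) // size_map -cardE sz.
rewrite /ua_prob /mean -(perm_big _ perm) big_map big_enum /=.
rewrite mulr_suml big_mkcond; apply: eq_bigr => c _; rewrite ua_graphE.
case: asboolP => _; rewrite ?mul0r // mul1r /choices_mass size_hists natr_prod -prodfV.
apply: eq_bigr => j _; rewrite prodr_const !card_ord natrX exprVn; done.
Qed.

Definition first_vertices n m : {set 'I_n} :=
  [set v : 'I_n | v <= m].

Lemma card_first_vertices n m : m < n -> #|first_vertices n m| = m.+1.
Proof.
move=> mn; have winj : injective (widen_ord mn) by move=> i j [] /val_inj.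
rewrite -[RHS]card_ord -(card_imset _ winj).
apply: eq_card => v; rewrite inE; apply/idP/imsetP => [vm|[u _ ->]].
  by exists (Ordinal (vm : v < m.+1)) => //; apply: val_inj.
by rewrite /= -ltnS.
Qed.

Lemma picks_lt k m h v u : h \in hists k m -> picks h v u -> u < v <= m.
Proof.
move=> /mem_hists[hm hP]; rewrite /picks; case: v => [|v] //=.
have [vm|mv] := ltnP v m; last by rewrite nth_default // hm.
by have := hP v vm; rewrite mem_words => /andP[_ /allP vP] /vP ->.
Qed.

Lemma hist_edges_in n k m h : h \in hists k m ->
  edges_in (@hist_graph n h) (first_vertices n m).
Proof.
move=> hm u v /orP[]/(picks_lt hm)/andP[uv vm]; rewrite inE //.
exact: leq_trans (ltnW uv) vm.
Qed.

(** Every vertex but [0] picks an earlier one. *)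
Lemma hist_connected n k m h : h \in hists k.+1 m ->
  connected_on (@hist_graph n h) (first_vertices n m).
Proof.
move=> hm A AV A0 AnV.
have pick (v : 'I_n) : v <= m -> 0 < v -> exists2 u : 'I_n, u < v & hist_graph h u v.
  case: v => -[//|v] vn /= vm _; have /mem_hists[hs hP] := hm.
  have := hP v vm; rewrite mem_words; case E: (nth [::] h v) => [|u l] // /and3P[_ uv _].
  exists (Ordinal (ltn_trans uv vn)) => //.
  by rewrite /hist_graph /picks /= E mem_head orbT.
have least (B : {set 'I_n}) : B \subset first_vertices n m -> B != finset.set0 ->
    (forall v : 'I_n, v \in B -> 0 < v) ->
    exists u v : 'I_n, [/\ u \notin B, v \in B, u <= m & hist_graph h u v].
  move=> BV /finset.set0Pn[x xB] B0.
  have [v vB vmin] := arg_minnP (fun v : 'I_n => val v) xB.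
  have vm : v <= m by move/fintype.subsetP/(_ v vB): BV; rewrite inE.
  have [u uv uvh] := pick v vm (B0 v vB).
  exists u, v; split => //; last exact: leq_trans (ltnW uv) vm.
  by apply: contraTN uv => /vmin; rewrite -leqNgt.
(* If [0] is in [A], the least vertex outside [A] picks a vertex of [A]; otherwise the
   least vertex of [A] picks a vertex outside [A]. *)
have [[z zA z0]|nz] := pselect (exists2 z : 'I_n, z \in A & val z = 0).
  have [||v|u [v [uB vB um uv]]] := least (first_vertices n m :\: A).
  - exact: subsetDl.
  - by rewrite finset.setD_eq0; apply: contra AnV => VA; rewrite finset.eqEsubset AV.
  - rewrite finset.in_setD lt0n => /andP[vA _]; apply: contraNneq vA => v0.
    by have -> : v = z by apply: val_inj; rewrite /= v0.
  exists u, v; split => //; move: uB; rewrite finset.in_setD inE um andbT.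
  by rewrite negbK.
have [v|u [v [uB vB um uv]]] := least A AV A0.
  by move=> vA; rewrite lt0n; apply/eqP => v0; case: nz; exists v.
exists v, u; split; [by [] | by rewrite finset.in_setD uB inE | by rewrite hist_graph_sym].
Qed.

(** * Expansion *)

(** Write the vertices, in the order of arrival, as a word in the letters [A] (in
    [A]), [B] (in [S] but not in [A]) and [C] (not in [S]).  If no edge joins [A] to
    [C], a vertex preceded by [a], [b] and [c] vertices of the three kinds has [a + b],
    [a + b + c] or [b + c] possible picks, according to its own letter.  The product of
    these numbers is largest when all the letters [B] come first: two consecutive
    letters [A] and [C] may be exchanged freely, while moving a [B] to the left
    helps.  The formula below is this largest product; in the case
    [a = 0] nothing is forbidden, but the falling factorial would vanish for [b = 0]. *)

Definition letter_bound a b c :=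
  if a == 0 then (b + c).-1`! else (a + b).-1`! * (b + c).-1 ^_ c.

Lemma letter_boundA a b c : letter_bound a b c * (a + b) <= letter_bound a.+1 b c.
Proof.
rewrite /letter_bound; case: a => [|a] /=.
  case: b => [|b]; first by rewrite muln0.
  rewrite add0n addSn /= factS mulnC -mulnA leq_mul2l /=.
  by rewrite -(@ffact_fact (b + c) c) ?leq_addl // addnK mulnC.
by rewrite !addSn /= factS mulnAC [_ * (a + b).+1]mulnC.
Qed.

Lemma letter_boundB a b c : 0 < a + b + c ->
  letter_bound a b c * (a + b + c) <= letter_bound a b.+1 c.
Proof.
rewrite /letter_bound; case: a => [|a] /=.
  by rewrite !add0n /=; case: (b + c) => // d _; rewrite /= factS mulnC.
move=> _; case: b => [|b].
  case: c => [|c]; last by rewrite add0n /= ffact_small // muln0.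
  by rewrite !addn0 addn1 /= muln1 factS mulnC muln1.
rewrite !addSn !addnS !addSn /= [((a + b).+2)`!]factS.
have fE : (b + c).+1 ^_ c * b.+1 = (b + c).+1 * (b + c) ^_ c.
  by rewrite -ffactSS ffactnSr -addSn addnK.
rewrite -(leq_pmul2r (ltn0Sn b)) -[leqRHS]mulnA fE.
have le : (a + b + c).+2 * b.+1 <= (a + b).+2 * (b + c).+1 by nia.
by rewrite -mulnA [leqRHS]mulnACA [leqRHS]mulnC leq_mul2l le orbT.
Qed.

Lemma letter_boundC a b c : letter_bound a b c * (b + c) <= letter_bound a b c.+1.
Proof.
rewrite /letter_bound addnS; case: a => [|a] /=.
  by case: (b + c) => [|d]; rewrite ?muln0 // factS mulnC.
case: b => [|b]; last by rewrite addSn /= -mulnA leq_mul2l mulnC -ffactSS leqnn orbT.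
by case: c => [|c]; rewrite ?muln0 // add0n /= ffact_small // muln0.
Qed.

(** For [d = b + c] the quotient of the factorials is the product of the ratios
    [(b + i) / (d + i)] for [i < a], each at most [(b + a) / (d + a)] as [b <= d]. *)
Lemma letter_bound_ratio a b c : 0 < a -> 0 < b ->
  letter_bound a b c * (a + b + c) ^ a <= (a + b + c).-1`! * (a + b) ^ a.
Proof.
case: a => // a _; case: b => // b _; rewrite /letter_bound -[a.+1 == 0]/false.
have factD d i : (d + i)`! = d`! * \prod_(l < i) (d.+1 + l).
  elim: i => [|i IHi]; first by rewrite addn0 big_ord0 muln1.
  by rewrite addnS factS IHi big_ord_recr /= addSn [RHS]mulnA [RHS]mulnC.
have fact_bc : (b + c) ^_ c * b`! = (b + c)`!.
  by rewrite -[RHS](@ffact_fact (b + c) c) ?leq_addl // addnK.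
have -> : (a.+1 + b.+1).-1 = b + a.+1 by rewrite addnS addnC.
have -> : (a.+1 + b.+1 + c).-1 = b + c + a.+1 by lia.
have -> : (b.+1 + c).-1 = b + c by [].
rewrite (factD b) (factD (b + c)) -(@leq_pmul2r b`!) ?fact_gt0 // -fact_bc.
set P := \prod_(l < a.+1) _; set Q := \prod_(l < a.+1) _.
suff PQ : P * (a.+1 + b.+1 + c) ^ a.+1 <= Q * (a.+1 + b.+1) ^ a.+1.
  set F := b`!; set G := _ ^_ _.
  have -> : F * P * G * (a.+1 + b.+1 + c) ^ a.+1 * F =
    F * G * F * (P * (a.+1 + b.+1 + c) ^ a.+1) by ring.
  have -> : G * F * Q * (a.+1 + b.+1) ^ a.+1 * F =
    F * G * F * (Q * (a.+1 + b.+1) ^ a.+1) by ring.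
  by rewrite leq_mul2l PQ orbT.
have powE x : x ^ a.+1 = \prod_(l < a.+1) x by rewrite prod_nat_const card_ord.
rewrite !powE -!big_split; apply: leq_prod => l _ /=.
have : l <= a by rewrite -ltnS.
by move: (val l) => i ia; nia.
Qed.

Definition allowed (A S : pred nat) (v u : nat) :=
  if A v then S u else if S v then true else ~~ A u.

Lemma count_allowed (A S : pred nat) v s : subpred A S ->
  let a := count A s in let b := count (predD S A) s in let c := count (predC S) s in
  count (allowed A S v) s = (if A v then a + b else if S v then a + b + c else b + c).
Proof.
move=> AS /=; rewrite /allowed; elim: s => [|x s /= ->]; first by case: ifP => //; case: ifP.
case: (A v) (S v) => [] [] //=; case: (boolP (A x)) (boolP (S x)) => [/[dup] Ax /AS ->|_] [] //= _; lia.
Qed.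

Lemma prod_allowed (A S : pred nat) m : subpred A S ->
  let s := iota 0 m.+1 in
  \prod_(j < m) count (allowed A S j.+1) (iota 0 j.+1) <=
  letter_bound (count A s) (count (predD S A) s) (count (predC S) s).
Proof.
move=> AS; elim: m => [|m IHm].
  rewrite big_ord0 /=; case: (boolP (A 0)) (boolP (S 0)) => [/AS ->|_] [] //=.
have sE : iota 0 m.+2 = rcons (iota 0 m.+1) m.+1 by rewrite -addn1 iotaD cats1.
move: IHm; cbv zeta; rewrite big_ord_recr sE -cats1 !count_cat [nat_of_ord _]/=.
rewrite (count_allowed m.+1 (iota 0 m.+1) AS); set s := iota 0 m.+1.
set a := count A s; set b := count _ s; set c := count _ s => IHm.
have abc : 0 < a + b + c.
  suff -> : a + b + c = size s by rewrite size_iota.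
  rewrite /a /b /c; elim: (s) => //= x l <-.
  case: (boolP (A x)) (boolP (S x)) => [/AS ->|_] [] //= _; lia.
rewrite [count A [:: _]]/= [count (predD S A) _]/= [count (predC S) _]/= !addn0.
have [Am|Am] := boolP (A m.+1).
  rewrite (AS _ Am) /= !addn0 addn1.
  by apply: leq_trans (letter_boundA _ _ _); rewrite leq_mul2r IHm orbT.
have [Sm|Sm] := boolP (S m.+1); rewrite /= !addn0 addn1.
  by apply: leq_trans (letter_boundB abc); rewrite leq_mul2r IHm orbT.
by apply: leq_trans (letter_boundC _ _ _); rewrite leq_mul2r IHm orbT.
Qed.

Lemma mean_allowed (R : realType) k m (A S : pred nat) a : subpred A S ->
  0 < a -> count A (iota 0 m.+1) = a -> count S (iota 0 m.+1) = 3 * a ->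
  (mean (hists k m) (fun h => (follows (allowed A S) h)%:R) <=
   ((3 * a)%:R / m.+1%:R) ^+ (k * a) :> R)%R.
Proof.
move=> AS a0 Aa Sa; rewrite mean_follows prodrXl [(k * a)%N]mulnC exprM.
rewrite lerXn2r ?nnegrE ?exprn_ge0 ?divr_ge0 ?ler0n //.
  by apply: prodr_ge0 => j _; rewrite divr_ge0 ?ler0n.
rewrite prodf_div -!natr_prod expr_div_n -!natrX.
have -> : \prod_(j < m) j.+1 = m`! by rewrite fact_prod big_add1 big_mkord.
rewrite ler_pdivrMr ?ltr0n ?fact_gt0 // mulrAC.
rewrite ler_pdivlMr ?ltr0n ?expn_gt0 // -!natrM ler_nat.
have := prod_allowed m AS; cbv zeta; set s := iota 0 m.+1 in Aa Sa *; rewrite Aa.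
set b := count (predD S A) s; set c := count (predC S) s => le.
have SE : count S s = a + b.
  rewrite -Aa /b; elim: (s) => //= x l ->.
  case: (boolP (A x)) (boolP (S x)) => [/AS ->|_] [] //= _; lia.
have mE : m.+1 = a + b + c.
  by rewrite -SE -(size_iota 0 m.+1) -(count_predC S).
have b0 : 0 < b by lia.
apply: leq_trans (_ : letter_bound a b c * (a + b + c) ^ a <= _).
  by rewrite mE leq_mul2r le orbT.
apply: leq_trans (letter_bound_ratio c a0 b0) _.
by rewrite -mE /= -SE Sa mulnC.
Qed.

Definition set_pred n (A : {set 'I_n}) : pred nat :=
  fun x => x \in [seq nat_of_ord i | i <- enum A].

Lemma set_predE n (A : {set 'I_n}) (v : 'I_n) : set_pred A v = (v \in A).
Proof. by rewrite /set_pred mem_map ?mem_enum //; exact: val_inj. Qed.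

Lemma count_set_pred n m (A : {set 'I_n}) : A \subset first_vertices n m ->
  count (set_pred A) (iota 0 m.+1) = #|A|.
Proof.
move=> Am; rewrite -size_filter cardE -(size_map (@nat_of_ord n)).
apply/perm_size/uniq_perm.
- by rewrite filter_uniq ?iota_uniq.
- by rewrite map_inj_uniq ?enum_uniq //; exact: val_inj.
move=> x; rewrite mem_filter mem_iota add0n /=; apply/andb_idr => /mapP[i iA ->].
by rewrite mem_enum in iA; move/fintype.subsetP/(_ i iA): Am; rewrite inE.
Qed.

Lemma no_edge_follows n k m h (A S : {set 'I_n}) : m < n -> h \in hists k m ->
  (forall u v, u \in A -> v \in first_vertices n m :\: S -> ~~ hist_graph h u v) ->
  follows (allowed (set_pred A) (set_pred S)) h.
Proof.
move=> mn hm noE; have [hs _] := (elimT (mem_hists _ _ _) hm).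
apply/allP => j; rewrite mem_iota hs => /andP[_ jm]; apply/allP => x xj.
have /andP[xv vm] := picks_lt (v := j.+1) hm xj.
have vn := leq_ltn_trans vm mn; have xn := ltn_trans xv vn.
rewrite /allowed -[j.+1]/(nat_of_ord (Ordinal vn)) -[x]/(nat_of_ord (Ordinal xn)).
rewrite !set_predE; case: ifP => [vA|_].
  apply: contraT => xS; have := noE _ (Ordinal xn) vA.
  rewrite finset.in_setD xS inE /= (leq_trans (ltnW xv) vm) => /(_ isT)/norP[+ _].
  by rewrite /picks /= xj.
case: ifP => // vS; apply/negP => xA; have := noE _ (Ordinal vn) xA.
rewrite finset.in_setD vS inE /= vm => /(_ isT)/norP[_].
by rewrite /picks /= xj.
Qed.

Lemma subset_between (T : finType) (A B : {set T}) k : A \subset B ->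
  #|A| <= k <= #|B| -> exists S : {set T}, [/\ A \subset S, S \subset B & #|S| = k].
Proof.
move=> AB /andP[Ak kB]; pose s := take (k - #|A|) (enum (B :\: A)).
have sBA x : x \in s -> x \in B :\: A by move=> /mem_take; rewrite mem_enum.
exists (A :|: [set x in s]); split; first exact: finset.subsetUl.
  rewrite finset.subUset AB /=; apply/fintype.subsetP => x; rewrite inE => /sBA.
  by rewrite finset.in_setD => /andP[].
rewrite cardsU finset.disjoint_setI0 ?cards0 ?subn0; last first.
  rewrite -setI_eq0; apply/eqP/finset.setP => x; rewrite !inE.
  by apply/negP => /andP[xA /sBA]; rewrite finset.in_setD xA.
have -> : #|[set x in s]| = size s.
  by rewrite cardsE; apply/card_uniqP; rewrite take_uniq ?enum_uniq.
rewrite size_takel -?cardE ?cardsD ?(finset.setIidPr AB); lia.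
Qed.

(** The set and its neighbours are padded to a set [S] of prescribed size, so that
    the union bound is over pairs of sets of sizes [a] and [3 * a]. *)
Lemma not_expanding (T : finType) (e : rel T) (V : {set T}) :
  symmetric e -> edges_in e V -> ~ expanding e V ->
  exists A S : {set T}, [/\ A \subset S, S \subset V, (0 < #|A|) && (8 * #|A| <= #|V|),
    #|S| = 3 * #|A| & forall u v, u \in A -> v \in V :\: S -> ~~ e u v].
Proof.
move=> sym eV /existsNP[A] /not_implyP[AV] /not_implyP[A0] /not_implyP[A8 /negP].
rewrite -ltnNge => NA.
have [S [ANS SV SE]] : exists S : {set T},
    [/\ A :|: nbhd e A \subset S, S \subset V & #|S| = 3 * #|A|].
  apply: subset_between.
    rewrite finset.subUset AV; apply/fintype.subsetP => v; rewrite inE.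
    by move=> /andP[_ /exists_inP[u _]]; rewrite sym; exact: eV.
  by have [le _] := leq_card_setU A (nbhd e A); lia.
exists A, S; split => //.
- exact: fintype.subset_trans (finset.subsetUl _ _) ANS.
- by rewrite card_gt0 A0.
move=> u v uA; rewrite finset.in_setD => /andP[vS _]; apply: contra vS => euv.
apply: (fintype.subsetP ANS); rewrite finset.in_setU; case: (boolP (v \in A)) => //= vA.
by rewrite inE vA; apply/exists_inP; exists u.
Qed.

Lemma bin_le_exp2 n k : 'C(n, k) <= 2 ^ n.
Proof.
elim: n k => [|n IHn] [|k] //; first by rewrite bin0 expn_gt0.
by rewrite binS expnS mul2n -addnn leq_add.
Qed.

Lemma expnn_le_fact s : s ^ s <= 4 ^ s * s`!.
Proof.
apply: leq_trans (_ : 'C(s + s, s) * s`! <= _).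
  rewrite bin_ffact ffact_prod -[s in _ ^ s]card_ord -prod_nat_const.
  by apply: leq_prod => i _; have := ltn_ord i; lia.
by rewrite leq_mul2r addnn -mul2n -[4]/(2 ^ 2) -expnM bin_le_exp2 orbT.
Qed.

Lemma bin_mul_expnn N s : 'C(N, s) * s ^ s <= (4 * N) ^ s.
Proof.
apply: leq_trans (_ : 'C(N, s) * (4 ^ s * s`!) <= _).
  by rewrite leq_mul2l expnn_le_fact orbT.
rewrite mulnCA expnMn leq_mul2l; apply/orP; right; rewrite bin_ffact ffact_prod.
by rewrite -[s in _ ^ s]card_ord -prod_nat_const; apply: leq_prod => i _; exact: leq_subr.
Qed.

Section Expansion.
Local Open Scope ring_scope.
Variable R : realType.

(** With [y = 3 * a / N], the two binomials and a factor [y ^ (3 * a)] contribute at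
    most [8 ^ (3 * a)], which leaves [(512 * y ^ 9) ^ a].  For [t = 4 * a / N <= 1 / 2]
    this is at most [t ^ (3 * a)], and [t ^ a <= 4 / N]. *)
Lemma union_term a N : (0 < a)%N -> (8 * a <= N)%N ->
  'C(N, 3 * a)%:R * 'C(3 * a, a)%:R * ((3 * a)%:R / N%:R) ^+ (12 * a)
  <= 64 / N%:R ^+ 3 :> R.
Proof.
move=> a0 aN; have N0 : (0 : R) < N%:R by rewrite ltr0n; lia.
set y : R := (3 * a)%:R / N%:R; pose t : R := (4 * a)%:R / N%:R.
have y0 : 0 <= y by rewrite divr_ge0 ?ler0n.
have t0 : 0 <= t by rewrite divr_ge0 ?ler0n.
have t2 : t <= 1 / 2.
  by rewrite ler_pdivrMr // mulrC mulrA mulr1 ler_pdivlMr ?ltr0n // -natrM ler_nat; lia.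
have yt : y = 3 / 4 * t by rewrite /y /t !natrM; field; rewrite gt_eqF.
have Cy : 'C(N, 3 * a)%:R * y ^+ (3 * a) <= 4 ^+ (3 * a).
  rewrite expr_div_n mulrA ler_pdivrMr ?exprn_gt0 // -exprMn -!natrX -!natrM -natrX.
  by rewrite ler_nat bin_mul_expnn.
have C2 : 'C(3 * a, a)%:R <= 2 ^+ (3 * a) :> R by rewrite -natrX ler_nat bin_le_exp2.
have ta : t ^+ a <= 4 / N%:R.
  rewrite expr_div_n ler_pdivrMr ?exprn_gt0 // mulrAC ler_pdivlMr //.
  rewrite -!natrX -!natrM ler_nat; case: (a) a0 aN => // b _ bN.
  have b2 : (b.+1 * (4 * b.+1) ^ b <= N ^ b)%N.
    apply: leq_trans (_ : 2 ^ b * (4 * b.+1) ^ b <= _)%N; first by rewrite leq_mul2r ltn_expl ?orbT.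
    by rewrite -expnMn; case: (posnP b) => [->//|b0]; rewrite leq_exp2r //; lia.
  rewrite !expnS; move: (_ ^ b)%N (_ ^ b)%N b2 => X Y b2; nia.
have -> : y ^+ (12 * a) = y ^+ (3 * a) * y ^+ (9 * a) by rewrite -exprD; congr (_ ^+ _); lia.
have y9 : 4 ^+ (3 * a) * (2 ^+ (3 * a) * y ^+ (9 * a)) <= t ^+ (3 * a).
  rewrite !exprM -!exprMn lerXn2r ?nnegrE ?mulr_ge0 ?exprn_ge0 //.
  have t6 : t ^+ 6 <= (1 / 2) ^+ 6 by rewrite lerXn2r ?nnegrE.
  rewrite yt; have := exprn_ge0 3 t0; move: t6; rewrite [(3 / 4 * t) ^+ _]exprMn.
  have -> : t ^+ 9 = t ^+ 6 * t ^+ 3 by rewrite -exprD.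
  move: (t ^+ 6) (t ^+ 3) => u v u6 v0.
  have uv : u * v <= (1 / 2) ^+ 6 * v by rewrite ler_wpM2r.
  lra.
apply: le_trans (_ : t ^+ (3 * a) <= _).
  apply: le_trans y9; rewrite mulrACA ler_pM ?mulr_ge0 ?exprn_ge0 ?ler0n //.
  by apply: ler_wpM2r; first exact: exprn_ge0.
rewrite mulnC exprM (_ : 64 / _ = (4 / N%:R) ^+ 3); last first.
  by rewrite expr_div_n; congr (_ / _); ring.
by rewrite lerXn2r ?nnegrE ?exprn_ge0 ?divr_ge0 ?ler0n.
Qed.


Lemma ler_sum_mem (I : finType) (P : pred I) (F : I -> R) i :
  (forall j, 0 <= F j) -> P i -> F i <= \sum_(j | P j) F j.
Proof. by move=> F0 Pi; rewrite (bigD1 i) //= lerDl sumr_ge0. Qed.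

(** The first-moment bound: the expected number of obstructions to expansion is
    small, each size [a] of a non-expanding set contributing [O(1 / m ^ 3)]. *)
Lemma mean_not_expanding n m : (m < n)%N ->
  mean (hists 12 m) (fun h =>
    (`[< ~ expanding (@hist_graph n h) (first_vertices n m) >])%:R)
  <= 64 / m.+1%:R ^+ 2 :> R.
Proof.
move=> mn; set V := first_vertices n m.
pose sizes := [pred a : 'I_n.+1 | (0 < a) && (8 * a <= m.+1)]%N.
pose big_sets (a : 'I_n.+1) := [set S : {set 'I_n} | (S \subset V) && (#|S| == 3 * a)%N].
pose sub_sets (a : 'I_n.+1) (S : {set 'I_n}) :=
  [set A : {set 'I_n} | (A \subset S) && (#|A| == a)%N].
pose avoids (S A : {set 'I_n}) h : R :=
  (follows (allowed (set_pred A) (set_pred S)) h)%:R.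
have avoids0 S A h : 0 <= avoids S A h by rewrite ler0n.
apply: le_trans (_ : mean (hists 12 m) (fun h =>
  \sum_(a | sizes a) \sum_(S in big_sets a) \sum_(A in sub_sets a S) avoids S A h) <= _).
  apply: ler_mean => h hm; case: asboolP => [|_]; last first.
    by apply: sumr_ge0 => a _; apply: sumr_ge0 => S _; exact: sumr_ge0.
  move=> /(not_expanding (@hist_graph_sym n h) (hist_edges_in hm)).
  move=> [A [S [AS SV /andP[A0 A8] S3 noE]]].
  have aP : (#|A| < n.+1)%N by rewrite ltnS -[n in leqRHS]card_ord max_card.
  rewrite card_first_vertices // in A8.
  apply: le_trans (_ : avoids S A h <= _).
    by rewrite /avoids (no_edge_follows mn hm noE).
  apply: le_trans (ler_sum_mem (i := Ordinal aP) _ _); last 2 first.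
  - by move=> a; apply: sumr_ge0 => S' _; exact: sumr_ge0.
  - by rewrite /sizes /= A0 A8.
  apply: le_trans (ler_sum_mem (i := S) _ _); last 2 first.
  - by move=> S'; exact: sumr_ge0.
  - by rewrite inE SV S3 /=.
  by apply: (ler_sum_mem (P := mem (sub_sets (Ordinal aP) S))) => //=; rewrite inE AS /=.
rewrite mean_sum; apply: le_trans (_ : \sum_(a | sizes a) 64 / m.+1%:R ^+ 3 <= _).
  apply: ler_sum => a /andP[a0 a8]; apply: le_trans (union_term a0 a8).
  rewrite mean_sum; have <- : #|V| = m.+1 by rewrite card_first_vertices.
  rewrite -cards_draws -/(big_sets a) -mulrA [leRHS]mulr_natl -sumr_const.
  apply: ler_sum => S; rewrite inE => /andP[SV /eqP S3].
  rewrite mean_sum -S3 -cards_draws -/(sub_sets a S) [leRHS]mulr_natl -sumr_const.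
  apply: ler_sum => A; rewrite inE => /andP[AS /eqP Aa]; rewrite S3.
  rewrite card_first_vertices //; apply: mean_allowed => //.
  - move=> x /mapP[i iA ->]; rewrite set_predE; rewrite mem_enum in iA.
    exact: (fintype.subsetP AS).
  - by rewrite count_set_pred // (fintype.subset_trans AS).
  - by rewrite count_set_pred.
have sizes_le : (#|sizes| <= m.+1)%N.
  rewrite -(card_first_vertices (ltnW mn : m < n.+1)%N); apply/subset_leq_card.
  by apply/fintype.subsetP => a /andP[a0 a8]; rewrite inE; lia.
have m0 : (0 : R) < m.+1%:R by rewrite ltr0n.
have -> : 64 / m.+1%:R ^+ 2 = m.+1%:R * (64 / m.+1%:R ^+ 3) :> R.
  by field; rewrite gt_eqF.
rewrite sumr_const -[leLHS]mulr_natl ler_wpM2r ?ler_nat //.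
Qed.

End Expansion.

(** * The longest path while the graph grows *)

Lemma hist_longest n k m h : h \in hists k.+1 m -> 0 < m < n ->
  1 < longest (@hist_graph n h).
Proof.
move=> hm /andP[m0 mn].
have [|||a [b [_ _ ab]]] := @hist_connected n k m h hm (first_vertices n 0).
- by apply/fintype.subsetP => v; rewrite !inE => /leq_trans->.
- by rewrite -card_gt0 card_first_vertices ?(ltn_trans m0 mn).
- apply: contraTneq (m0) => E; have := card_first_vertices mn.
  by rewrite -E card_first_vertices ?(ltn_trans m0 mn) // => -[<-].
have nab : a != b.
  apply: contraTneq ab => ->; rewrite /hist_graph orbb; apply/negP => /(picks_lt hm).
  by rewrite ltnn.
have /leq_longest -> // : upath (hist_graph h) [:: a; b].
by rewrite /upath /= inE nab ab.
Qed.

Lemma picks_rcons k m h l v u : h \in hists k m ->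
  picks (rcons h l) v u = if v == m.+1 then u \in l else picks h v u.
Proof.
move=> /mem_hists[hm _]; rewrite /picks -rcons_cons nth_rcons /= hm.
case: ltngtP => // vm; rewrite nth_default //= hm; lia.
Qed.

Lemma hist_graph_rcons n k m h l : h \in hists k m ->
  subrel (@hist_graph n h) (hist_graph (rcons h l)).
Proof.
move=> hm; have sub v u : picks h v u -> picks (rcons h l) v u.
  move=> /[dup] /(picks_lt hm)/andP[_ vm]; rewrite (picks_rcons l _ _ hm).
  by case: eqP vm => [->|//]; rewrite ltnn.
by move=> u v /orP[]/sub huv; rewrite /hist_graph huv ?orbT.
Qed.

Lemma hist_graph_new n k m h l (w v : 'I_n) : h \in hists k m ->
  w = m.+1 :> nat -> val v \in l -> hist_graph (rcons h l) w v.
Proof.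
by move=> hm wm vl; rewrite /hist_graph !(picks_rcons l _ _ hm) wm eqxx vl.
Qed.

Definition deficit n m (h : seq (seq nat)) := m.+1 - longest (@hist_graph n h).

(** Small graphs fail to expand with positive probability, whence the starting
    time [M]. *)
Definition steady n M (h : seq (seq nat)) := forall j, M <= j <= size h ->
  expanding (@hist_graph n (take j h)) (first_vertices n j).

Lemma steady_rcons n M h l : steady n M (rcons h l) -> steady n M h.
Proof.
move=> st j /andP[Mj jh]; have := st j; rewrite size_rcons Mj ltnW //.
by rewrite -cats1 takel_cat //; exact.
Qed.

Lemma steady_expanding n M h : steady n M h -> M <= size h ->
  expanding (@hist_graph n h) (first_vertices n (size h)).
Proof. by move=> st Mh; have := st (size h); rewrite Mh leqnn take_size; exact. Qed.

Lemma not_steady_rcons n M h l : ~ steady n M (rcons h l) ->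
  ~ steady n M h \/
  ~ expanding (@hist_graph n (rcons h l)) (first_vertices n (size h).+1).
Proof.
move=> nst; have [st|] := pselect (steady n M h); [right => ex; apply: nst|by left].
move=> j; rewrite size_rcons => /andP[Mj]; rewrite leq_eqVlt => /predU1P[->|jh].
  by rewrite take_oversize // size_rcons.
by rewrite -cats1 takel_cat //; apply: st; rewrite Mj.
Qed.

Section Drift.
Local Open Scope ring_scope.
Variable R : realType.

Lemma mean_hit m k (E : pred nat) (F : seq nat -> R) v w :
  (m <= 8 * count E (iota 0 m))%N -> w <= v ->
  (forall l, F l <= v) -> (forall l, has E l -> F l <= w) -> (0 < m)%N ->
  mean (words k m) F <= w + (v - w) * (7 / 8) ^+ k.
Proof.
move=> E8 wv Fv Fw m0; have mR : (0 : R) < m%:R by rewrite ltr0n.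
apply: le_trans (_ : mean (words k m) (fun l => w + (v - w) * (all (predC E) l)%:R) <= _).
  apply: ler_mean => l _; rewrite all_predC; case: (boolP (has E l)) => [/Fw|_] /=.
    by rewrite mulr0 addr0.
  by rewrite mulr1 addrC subrK.
rewrite meanD mean_cst; last by rewrite size_words expn_gt0 m0.
rewrite lerD2l meanZl ler_wpM2l ?subr_ge0 // mean_words_all.
rewrite lerXn2r ?nnegrE ?divr_ge0 ?ler0n // ler_pdivrMr //.
rewrite mulrAC ler_pdivlMr ?ltr0n // -!natrM ler_nat.
by have := count_predC E (iota 0 m); rewrite size_iota; lia.
Qed.

Fixpoint hit_bound (u v w : R) k := if k is k'.+1
  then 7 / 8 * hit_bound u v w k' + 1 / 8 * (w + (v - w) * (7 / 8) ^+ k') else u.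

Lemma hit_bound_ge u v w k : w <= v -> v <= u ->
  w + (v - w) * (7 / 8) ^+ k <= hit_bound u v w k.
Proof.
move=> wv vu; elim: k => [|k IHk] /=; first by rewrite expr0 mulr1 addrC subrK.
apply: le_trans (_ : w + (v - w) * (7 / 8) ^+ k <= _); last by lra.
rewrite lerD2l ler_wpM2l ?subr_ge0 // exprS ler_piMl ?exprn_ge0 //; lra.
Qed.

(** The choices are revealed one by one: until one of them falls in [E] the bound is
    that of [hit_bound]; once some [x] is in [E] it remains to hit the fixed set
    [E2 x], which is the situation of [mean_hit]. *)
Lemma mean_hit_twice m k (E : pred nat) (E2 : nat -> pred nat) (F : seq nat -> R) u v w :
  (0 < m)%N -> (m <= 8 * count E (iota 0 m))%N ->
  (forall x, E x -> m <= 8 * count (E2 x) (iota 0 m))%N -> w <= v -> v <= u ->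
  (forall l, F l <= u) -> (forall l, has E l -> F l <= v) ->
  (forall l x, x \in l -> E x -> has (E2 x) l -> F l <= w) ->
  mean (words k m) F <= hit_bound u v w k.
Proof.
move=> m0 E8 E28 wv vu; have mR : (0 : R) < m%:R by rewrite ltr0n.
elim: k F => [|k IHk] F Fu Fv Fw.
  by rewrite /mean big_cons big_nil addr0 divr1; exact: Fu.
rewrite mean_words; set g := w + (v - w) * (7 / 8) ^+ k.
set f := hit_bound u v w k in IHk.
have gf : g <= f by exact: hit_bound_ge.
apply: le_trans (_ : mean (iota 0 m) (fun x => f - (f - g) * (E x)%:R) <= _).
  apply: ler_mean => x _; case: (boolP (E x)) => Ex /=.
    rewrite mulr1 subKr; apply: (@mean_hit m k (E2 x)) => //; first exact: E28.
      by move=> l; apply: Fv; rewrite /= Ex.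
    by move=> l hl; apply: (Fw _ x); rewrite ?mem_head //= hl orbT.
  rewrite mulr0 subr0; apply: IHk => [l|l hl|l y yl Ey hl]; first exact: Fu.
    by apply: Fv; rewrite /= hl orbT.
  by apply: (Fw _ y) => //=; rewrite ?in_cons ?yl ?hl orbT.
rewrite meanB mean_cst ?size_iota // meanZl mean_count size_iota /= -/f -/g.
have : 1 / 8 <= (count E (iota 0 m))%:R / m%:R :> R.
  by rewrite ler_pdivlMr // mulrAC ler_pdivrMr ?ltr0n // mul1r -natrM ler_nat mulnC.
by move: (_ / m%:R) => c; nra.
Qed.

(** For a binomial variable of parameters [12] and [1 / 8], the probabilities of [0],
    of [1] and of at least [2] are about [0.20], [0.35] and [0.45]. *)
Lemma hit_bound12 v : 0 <= v -> hit_bound (3 / 2 * v) v (2 / 3 * v) 12 <= 24 / 25 * v.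
Proof. by rewrite /hit_bound => v0; lra. Qed.

End Drift.

Section Deficit.
Local Open Scope ring_scope.
Variable R : realType.

Lemma ler_pow32 i j : (i <= j)%N -> (3 / 2) ^+ i <= (3 / 2) ^+ j :> R.
Proof. by apply: ler_weXn2l; lra. Qed.

(** When the deficit is [0] it cannot decrease, which accounts for the additive
    constant. *)
Lemma mean_new_vertex n m h : h \in hists 12 m -> (0 < m)%N -> (m.+1 < n)%N ->
  expanding (@hist_graph n h) (first_vertices n m) ->
  mean (words 12 m.+1) (fun l => (3 / 2) ^+ deficit n m.+1 (rcons h l))
  <= 24 / 25 * (3 / 2) ^+ deficit n m h + 3 / 2 :> R.
Proof.
move=> hm m0 mn ex; pose e := @hist_graph n h; pose V := first_vertices n m.
pose e' l := @hist_graph n (rcons h l).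
have sym : symmetric e by exact: hist_graph_sym.
have sym' l : symmetric (e' l) by exact: hist_graph_sym.
have ee' l : subrel e (e' l) by exact: hist_graph_rcons hm.
have eV : edges_in e V by exact: hist_edges_in hm.
have L1 : (1 < longest e)%N by apply: hist_longest hm _; rewrite m0 ltnW.
have cardV : #|V| = m.+1 by rewrite card_first_vertices // ltnW.
have z0 i : 0 <= (3 / 2) ^+ i :> R by rewrite exprn_ge0 //; lra.
have mono l : (longest e <= longest (e' l))%N by exact: longest_sub.
case Dh : (deficit n m h) => [|d].
  apply: le_trans (_ : mean (words 12 m.+1) (fun=> 3 / 2) <= _).
    apply: ler_mean => l _; rewrite -[leRHS]expr1 ler_pow32 //.
    by move: (mono l) Dh; rewrite /deficit -/e -/(e' l); lia.
  by rewrite mean_cst ?words_gt0 // expr0; lra.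
have LV : (longest e < #|V|)%N by rewrite cardV; move: Dh; rewrite /deficit -/e; lia.
pose w := Ordinal mn.
have wV : w \notin V by rewrite inE /= ltnn.
have new l (x : 'I_n) : val x \in l -> e' l w x.
  by move=> xl; apply: (hist_graph_new (w := w) hm).
pose E : pred nat := set_pred [set x | [exists y, ends e x y]].
pose E2 (x : nat) : pred nat :=
  set_pred [set y | [exists v : 'I_n, (val v == x) && ends e v y]].
have endV x y : ends e x y -> x \in V.
  by rewrite ends_sym // => yx; exact: ends_in yx.
have ends2 (x : 'I_n) : [set y | [exists v : 'I_n, (val v == val x) && ends e v y]] =
    [set y | ends e x y].
  apply/finset.setP => y; rewrite !inE; apply/existsP/idP => [[v /andP[/eqP/val_inj->]]//|xy].
  by exists x; rewrite eqxx.
have E28 x : E x -> (m.+1 <= 8 * count (E2 x) (iota 0 m.+1))%N.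
  move=> /mapP[{}x + ->]; rewrite mem_enum inE => /existsP[y xy].
  rewrite /E2 ends2 count_set_pred; last first.
    by apply/fintype.subsetP => z; rewrite inE; exact: ends_in.
  by rewrite -cardV ltnW // (card_ends sym eV ex L1 xy).
have E8 : (m.+1 <= 8 * count E (iota 0 m.+1))%N.
  have [[|x p] ep sp] := longest_ex e; first by rewrite -sp in L1.
  have xy : ends e x (last x p) by apply/endsP; exists p.
  have Ex : E x by rewrite /E set_predE inE; apply/existsP; exists (last x p).
  apply: leq_trans (E28 _ Ex) _; rewrite leq_pmul2l //; apply: sub_count => _ /mapP[z + ->].
  rewrite ends2 mem_enum inE => xz; rewrite /E set_predE inE; apply/existsP; exists x.
  by rewrite ends_sym.
apply: le_trans (_ : _ <= 24 / 25 * (3 / 2) ^+ d.+1) _; last lra.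
apply: le_trans (hit_bound12 (z0 d.+1)).
apply: (@mean_hit_twice _ _ _ E E2) => //.
- have := z0 d.+1; lra.
- have := z0 d.+1; lra.
- move=> l; rewrite -exprS ler_pow32 //.
  by move: (mono l) Dh; rewrite /deficit -/e -/(e' l); lia.
- move=> l /hasP[_ /[swap] /mapP[x + ->] xl]; rewrite mem_enum inE => /existsP[y xy].
  have := new_vertex_path sym eV (ee' l) wV L1 xy (new l x xl).
  by move=> H; rewrite ler_pow32 //; move: H Dh; rewrite /deficit -/e -/(e' l); lia.
move=> l _ /[swap] /mapP[x _ ->] xl /hasP[_ /[swap] /mapP[y + ->] yl].
rewrite ends2 mem_enum inE => xy.
have LV2 : (1 < longest e < #|V|)%N by rewrite L1.
have con : connected_on e V by exact: hist_connected hm.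
have := new_vertex_cycle sym (sym' l) eV con (ee' l) wV LV2 xy
  (new l x xl) (new l y yl).
move=> H; rewrite exprS mulrA (_ : 2 / 3 * (3 / 2) = 1 :> R) ?mul1r; last by field.
by rewrite ler_pow32 //; move: H Dh; rewrite /deficit -/e -/(e' l); lia.
Qed.

Definition steady_weight n M m h : R :=
  (`[< steady n M h >])%:R * (3 / 2) ^+ deficit n m h.

(** The constant [75 / 2] is the fixed point of [x |-> 24 / 25 * x + 3 / 2]. *)
Lemma mean_steady_weight n M m : (0 < M <= m)%N -> (m < n)%N ->
  mean (hists 12 m) (steady_weight n M m) <= (3 / 2) ^+ M.+1 + 75 / 2.
Proof.
move=> /andP[M0]; elim: m => [|m IHm].
  by rewrite leqNgt M0.
have z0 i : 0 <= (3 / 2) ^+ i :> R by rewrite exprn_ge0 //; lra.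
have zM := z0 M.+1.
rewrite leq_eqVlt => /predU1P[<-|Mm] mn.
  apply: le_trans (_ : mean (hists 12 M) (fun=> (3 / 2) ^+ M.+1) <= _).
    apply: ler_mean => h _; rewrite /steady_weight.
    apply: le_trans (_ : (3 / 2) ^+ deficit n M h <= _).
      by rewrite -[leRHS]mul1r ler_wpM2r // lern1 leq_b1.
    by rewrite ler_pow32 // leq_subr.
  by rewrite mean_cst ?hists_gt0 //; lra.
have IH := IHm Mm (ltnW mn).
rewrite mean_hists; apply: le_trans (_ : mean (hists 12 m) (fun h =>
    24 / 25 * steady_weight n M m h + 3 / 2) <= _); last first.
  by rewrite meanD meanZl mean_cst ?hists_gt0 //; lra.
apply: ler_mean => h hm; rewrite /steady_weight.
have hs : size h = m by have /mem_hists[] := hm.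
case: (asboolP (steady n M h)) => [st|nst] /=.
  rewrite mul1r; apply: le_trans (mean_new_vertex hm _ mn _); last 2 first.
  - exact: leq_trans M0 _.
  - by have := steady_expanding st; rewrite hs; apply.
  apply: ler_mean => l _; rewrite -[leRHS]mul1r ler_wpM2r // lern1 leq_b1 //.
rewrite mul0r mulr0 add0r; apply: le_trans (_ : mean (words 12 m.+1) (fun=> 0) <= _).
  apply: ler_mean => l _; case: asboolP => [/steady_rcons//|_]; by rewrite mul0r.
by rewrite mean_cst ?words_gt0 //; lra.
Qed.

(** The failure probabilities [64 / j.+1 ^ 2] are summed by telescoping. *)
Lemma mean_not_steady n M m : (0 < M <= m)%N -> (m < n)%N ->
  mean (hists 12 m) (fun h => (`[< ~ steady n M h >])%:R)
  <= 64 / M%:R - 64 / m.+1%:R :> R.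
Proof.
move=> /andP[M0]; have MR : (0 : R) < M%:R by rewrite ltr0n.
have tele j : (0 < j)%N -> 64 / j.+1%:R ^+ 2 <= 64 / j%:R - 64 / j.+1%:R :> R.
  move=> j0; have jR : (0 : R) < j%:R by rewrite ltr0n.
  have -> : 64 / j%:R - 64 / j.+1%:R = 64 / (j%:R * j.+1%:R) :> R.
    by rewrite -natr1; field; rewrite !gt_eqF // addr_gt0.
  rewrite ler_wpM2l // lef_pV2 ?posrE ?exprn_gt0 ?mulr_gt0 ?ltr0n //.
  by rewrite expr2 ler_wpM2r ?ler0n // ler_nat.
elim: m => [|m IHm]; first by rewrite leqNgt M0.
rewrite leq_eqVlt => /predU1P[<-|Mm] mn.
  apply: le_trans (tele _ M0); apply: le_trans (mean_not_expanding R mn).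
  apply: ler_mean => h /mem_hists[hs _]; rewrite ler_nat.
  case: asboolP => // nst; rewrite lt0b; apply/asboolP => ex.
  apply: nst => j; rewrite hs => /anti_leq <-.
  by rewrite take_oversize // hs.
have IH := IHm Mm (ltnW mn).
apply: le_trans (_ : mean (hists 12 m) (fun h => (`[< ~ steady n M h >])%:R) +
  mean (hists 12 m.+1) (fun h =>
    (`[< ~ expanding (@hist_graph n h) (first_vertices n m.+1) >])%:R) <= _); last first.
  apply: le_trans (lerD IH (le_trans (mean_not_expanding R mn) (tele m.+1 isT))) _.
  by rewrite addrA subrK.
rewrite !mean_hists -meanD; apply: ler_mean => h /mem_hists[hs _].
rewrite -(mean_cst (`[< ~ steady n M h >])%:R (words_gt0 12 m)) -meanD.
apply: ler_mean => l _.
rewrite -natrD ler_nat; case: asboolP => //= /not_steady_rcons; rewrite hs.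
by move=> []/asboolP ->; rewrite ?leq_addl ?leq_addr.
Qed.

End Deficit.

(** * Sprinkling the choices set aside *)

Definition add_edges (T : eqType) (e : rel T) (F : seq (T * T)) : rel T :=
  fun u v => [|| e u v, (u, v) \in F | (v, u) \in F].

Lemma add_edges_sym (T : eqType) (e : rel T) F : symmetric e -> symmetric (add_edges e F).
Proof. by move=> sym u v; rewrite /add_edges sym; congr (_ || _); rewrite orbC. Qed.

Lemma sub_add_edges (T : eqType) (e : rel T) F : subrel e (add_edges e F).
Proof. by move=> u v; rewrite /add_edges => ->. Qed.

Lemma hamiltonian_sub (T : finType) (e e' : rel T) : subrel e e' ->
  hamiltonian e -> hamiltonian e'.
Proof.
move=> ee' [s [/andP[cs us] s3 sV]]; exists s; split => //; rewrite /ucycle us andbT.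
by case: s cs {us s3 sV} => //= x p; exact: sub_path.
Qed.

Lemma connected_sub (T : finType) (e e' : rel T) (V : {set T}) : subrel e e' ->
  connected_on e V -> connected_on e' V.
Proof.
by move=> ee' con A AV A0 AnV; have [a [b [aA bA /ee' ab]]] := con A AV A0 AnV; exists a, b.
Qed.

Lemma expanding_sub (T : finType) (e e' : rel T) (V : {set T}) : subrel e e' ->
  expanding e V -> expanding e' V.
Proof.
move=> ee' ex A AV A0 A8; apply: leq_trans (ex A AV A0 A8) _.
apply/subset_leq_card/fintype.subsetP => v; rewrite !inE => /andP[-> /exists_inP[u uA]].
by move=> /ee' uv; apply/exists_inP; exists u.
Qed.

(** As long as some pair in [P] joins the ends of a longest path, adding it as an edge
    makes the longest path longer; this can happen at most [r] times. *)
Lemma exhaust_boosters (T : finType) (e eG : rel T) (P : T -> T -> Prop) r :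
  symmetric e -> symmetric eG -> connected_on e [set: T] -> 2 < longest e ->
  subrel e eG -> (forall u v, P u v -> eG u v) -> ~ hamiltonian eG ->
  #|T| - longest e <= r ->
  exists F, size F <= r /\ forall u v, P u v -> ~~ ends (add_edges e F) u v.
Proof.
move=> sym symG con L2 eeG PG nham Lr.
have grow F u v : (forall a b, (a, b) \in F -> P a b) -> P u v ->
    ends (add_edges e F) u v ->
    longest (add_edges e F) < longest (add_edges e ((u, v) :: F)).
  move=> FP Puv uv; have sub : subrel (add_edges e ((u, v) :: F)) eG.
    have FG a b : (a, b) \in (u, v) :: F -> eG a b.
      by rewrite inE => /predU1P[[-> ->]|/FP/PG//]; exact: PG.
    by move=> a b /or3P[/eeG //|/FG //|/FG]; rewrite symG.
  have L2F := leq_trans L2 (longest_sub (@sub_add_edges _ e F)).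
  have sub_cons : subrel (add_edges e F) (add_edges e ((u, v) :: F)).
    by move=> a b; rewrite /add_edges !inE => /or3P[]->; rewrite ?orbT.
  have conF : connected_on (add_edges e F) [set: T].
    by apply: connected_sub con; exact: sub_add_edges.
  have uv_edge : add_edges e ((u, v) :: F) u v by rewrite /add_edges mem_head orbT.
  by case: (booster (add_edges_sym _ sym) sub_cons conF L2F uv uv_edge) =>
    [/(hamiltonian_sub sub)|].
have main s F : (forall a b, (a, b) \in F -> P a b) ->
    #|T| - longest (add_edges e F) <= s -> exists F', size F' <= size F + s /\
    forall u v, P u v -> ~~ ends (add_edges e F') u v.
  elim: s F => [|s IHs] F FP Ls.
    exists F; rewrite addn0; split=> // u v Puv; apply/negP => /(grow F u v FP Puv).
    by have := longest_le (add_edges e ((u, v) :: F)); lia.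
  have [[u [v [uv Puv]]]|none] :=
      pselect (exists u v, ends (add_edges e F) u v /\ P u v); last first.
    exists F; split=> [|u v Puv]; first exact: leq_addr.
    by apply/negP => uv; apply: none; exists u, v.
  have [||F' [F's F'P]] := IHs ((u, v) :: F).
  - by move=> a b; rewrite inE => /predU1P[[-> ->]|/FP].
  - by have := grow F u v FP Puv uv; lia.
  by exists F'; split=> //; rewrite addnS -addSn.
have [||F [Fr FP]] := main r [::]; [by []| |by exists F].
by apply: leq_trans Lr; apply/leq_sub2l/longest_sub/sub_add_edges.
Qed.

(** The picks of [v] that would be useful in the sprinkling; only the earlier vertices
    matter, as each pair is offered to its later vertex. *)
Definition back_ends n (e : rel 'I_n) (v : nat) : {set 'I_n} :=
  [set u : 'I_n | (u < v) && [exists w : 'I_n, (val w == v) && ends e w u]].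

(** Each pair of ends is counted once, at its later vertex; at least [n / 8] vertices
    are ends, and each belongs to at least [n / 8] pairs. *)
Lemma sum_back_ends m (e : rel 'I_m.+1) : symmetric e -> 1 < longest e ->
  expanding e [set: 'I_m.+1] -> m.+1 ^ 2 <= 128 * \sum_(j < m) #|back_ends e j.+1|.
Proof.
move=> sym L1 ex.
have eV : edges_in e [set: 'I_m.+1] by move=> u v _; rewrite inE.
have deg x y : ends e x y -> m.+1 <= 8 * #|[set z | ends e x z]|.
  by move=> xy; apply: leq_trans (ltnW (card_ends sym eV ex L1 xy)); rewrite cardsT card_ord.
have sum_lt : \sum_(j < m) #|back_ends e j.+1| =
    \sum_(v < m.+1) \sum_(u < m.+1) ((u < v) && ends e v u).
  rewrite big_ord_recl [X in _ = X + _]big1 ?add0n => [|u _ //].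
  apply: eq_bigr => j _; rewrite -sum1dep_card big_mkcond; apply: eq_bigr => u _.
  rewrite lift0; case: ltnP => //= _; suff -> : [exists w : 'I_m.+1,
    (val w == j.+1) && ends e w u] = ends e (lift ord0 j) u by case: ends.
  apply/existsP/idP => [[w /andP[/eqP wj]]|ju]; last by exists (lift ord0 j); rewrite ju eqxx.
  by have -> : w = lift ord0 j by exact: val_inj.
have sum_gt : \sum_(j < m) #|back_ends e j.+1| =
    \sum_(v < m.+1) \sum_(u < m.+1) ((v < u) && ends e v u).
  rewrite sum_lt exchange_big; apply: eq_bigr => v _; apply: eq_bigr => u _.
  by rewrite ends_sym.
have double : 2 * \sum_(j < m) #|back_ends e j.+1| =
    \sum_(v < m.+1) #|[set u | ends e v u]|.
  rewrite mul2n -addnn {1}sum_lt sum_gt -big_split; apply: eq_bigr => v _.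
  rewrite -big_split -sum1dep_card [RHS]big_mkcond; apply: eq_bigr => u _ /=.
  have [vu|_] := boolP (ends e v u); last by rewrite !andbF.
  rewrite !andbT; case: ltngtP => // /val_inj vE.
  by have := ends_neq L1 vu; rewrite vE eqxx.
have [[|x p] ep sp] := longest_ex e; first by rewrite -sp in L1.
have xy : ends e x (last x p) by apply/endsP; exists p.
have many : m.+1 <= 8 * #|[set v | ends e x v]| by exact: deg xy.
apply: leq_trans (_ : 64 * \sum_(v in [set v | ends e x v]) #|[set u | ends e v u]| <= _).
  apply: leq_trans (_ : 8 * \sum_(v in [set v | ends e x v]) m.+1 <= _).
    by rewrite sum_nat_const mulnA expnS leq_mul.
  rewrite -[64]/(8 * 8) -mulnA leq_mul2l /= big_distrr /=; apply: leq_sum => v.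
  by rewrite inE => xv; apply: (deg _ x); rewrite ends_sym.
rewrite -[128]/(64 * 2) -mulnA double leq_mul2l /= [leqRHS](bigID (mem [set v | ends e x v])) /=.
exact: leq_addr.
Qed.

Section Sprinkle.
Local Open Scope ring_scope.
Variable R : realType.

Lemma mean_avoid_ends m (e : rel 'I_m.+1) : symmetric e -> (1 < longest e)%N ->
  expanding e [set: 'I_m.+1] ->
  mean (hists 1 m) (fun g => (follows (fun v => predC (set_pred (back_ends e v))) g)%:R)
  <= expR (- (m.+1%:R / 128)) :> R.
Proof.
move=> sym L1 ex; rewrite mean_follows.
have m0 : (0 : R) < m.+1%:R by rewrite ltr0n.
apply: le_trans (_ : \prod_(j < m) expR (- (#|back_ends e j.+1|%:R / m.+1%:R)) <= _).
  apply: ler_prod => j _; rewrite expr1 divr_ge0 ?ler0n //=.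
  apply: le_trans (expR_ge1Dx _).
  have bV : back_ends e j.+1 \subset first_vertices m.+1 j.
    by apply/fintype.subsetP => u; rewrite !inE ltnS => /andP[].
  have := count_predC (set_pred (back_ends e j.+1)) (iota 0 j.+1).
  rewrite count_set_pred // size_iota => /(congr1 (fun x => x%:R : R)).
  rewrite natrD -[count _ _]/(count _ (iota 0 j.+1)) => E.
  have j0 : (0 : R) < j.+1%:R by rewrite ltr0n.
  rewrite ler_pdivrMr // mulrDl mul1r mulNr -[leLHS](addKr (#|back_ends e j.+1|%:R)).
  rewrite addrC E lerD2l lerN2 mulrAC ler_pdivrMr // ler_wpM2l ?ler0n //.
  by rewrite ler_nat ltnS ltnW.
rewrite -expR_sum ler_expR sumrN lerN2 -mulr_suml -natr_sum.
rewrite ler_pdivlMr // mulrAC ler_pdivrMr ?ltr0n // -!natrM ler_nat.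
by rewrite mulnn [leqRHS]mulnC; exact: sum_back_ends.
Qed.

End Sprinkle.

Lemma picks_merge k k' m g h v u : g \in hists k m -> h \in hists k' m ->
  picks (merge_hist g h) v u = picks g v u || picks h v u.
Proof.
move=> /mem_hists[gm _] /mem_hists[hm _]; rewrite /picks; case: v => [|j] //=.
have [jm|mj] := ltnP j m; last first.
  by rewrite !nth_default ?gm ?hm // size_map size_zip gm hm minnn.
rewrite (nth_map ([::], [::])) ?size_zip ?gm ?hm ?minnn // nth_zip ?gm ?hm //=.
by rewrite mem_cat.
Qed.

Lemma first_vertices_all m : first_vertices m.+1 m = [set: 'I_m.+1].
Proof. by apply/finset.setP => v; rewrite !inE -ltnS ltn_ord. Qed.

Lemma tuple_of_seq (T : Type) k (s : seq T) : size s <= k ->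
  exists t : k.-tuple (option T), pmap id t = s.
Proof.
move=> sk; pose l := map Some s ++ nseq (k - size s) None.
have lk : size l == k by rewrite size_cat size_map size_nseq subnKC.
exists (Tuple lk); rewrite /= /l pmap_cat.
have -> : pmap id (nseq (k - size s) (@None T)) = [::] by elim: (k - size s).
by rewrite cats0; elim: (s) => //= x r ->.
Qed.

(** * Hamiltonicity *)

Section Final.
Local Open Scope ring_scope.
Variable R : realType.

(** Union bound over the sets of at most [T] added edges, coded as tuples of optional
    pairs. *)
Lemma mean_sprinkle T m h : h \in hists 12 m -> (0 < m)%N ->
  expanding (@hist_graph m.+1 h) [set: 'I_m.+1] ->
  (deficit m.+1 m h <= T)%N -> (T + 3 <= m.+1)%N ->
  mean (hists 1 m) (fun g => (`[< ~ hamiltonian (@hist_graph m.+1 (merge_hist g h)) >])%:R)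
  <= ((m.+1 * m.+1).+1 ^ T)%:R * expR (- (m.+1%:R / 128)) :> R.
Proof.
move=> hm m0 ex DT Tm; set e := hist_graph h in ex *.
have sym : symmetric e by exact: hist_graph_sym.
have L1 : (1 < longest e)%N by apply: hist_longest hm _; rewrite m0 ltnSn.
have con : connected_on e [set: 'I_m.+1].
  by rewrite -first_vertices_all; exact: hist_connected hm.
pose edges (t : T.-tuple (option ('I_m.+1 * 'I_m.+1))) := add_edges e (pmap id t).
pose avoids t g : R := (follows (fun v => predC (set_pred (back_ends (edges t) v))) g)%:R.
apply: le_trans (_ : mean (hists 1 m) (fun g => \sum_t avoids t g) <= _).
  apply: ler_mean => g gm; case: asboolP => [nham|_]; last first.
    by apply: sumr_ge0 => t _; rewrite ler0n.
  have picksE v u := picks_merge v u gm hm.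
  have [||||F [FT noF]] := @exhaust_boosters _ e _ (fun u v : 'I_m.+1 => picks g u v) T
      sym (@hist_graph_sym _ (merge_hist g h)) con _ _ _ nham.
  - by move: DT; rewrite /deficit -/e; lia.
  - by move=> u v /orP[]uv; rewrite /hist_graph !picksE uv ?orbT.
  - by move=> u v uv; rewrite /hist_graph !picksE uv.
  - by rewrite card_ord.
  have [t tF] := tuple_of_seq FT.
  apply: le_trans (ler_sum_mem (P := predT) (i := t) _ _) => //.
  rewrite /avoids; suff -> : follows (fun v => predC (set_pred (back_ends (edges t) v))) g by [].
  have /mem_hists[gs _] := gm.
  apply/allP => j; rewrite mem_iota gs => /andP[_ jm]; apply/allP => x xj.
  apply/negP => /mapP[u + xu]; rewrite mem_enum inE => /andP[_ /existsP[w /andP[/eqP wj]]].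
  apply/negP; rewrite /edges tF; apply: noF.
  by rewrite /picks -[nat_of_ord w]/(val w) wj /= -xu.
rewrite mean_sum; apply: le_trans (_ : \sum_(t : T.-tuple (option ('I_m.+1 * 'I_m.+1)))
    expR (- (m.+1%:R / 128)) <= _).
  apply: ler_sum => t _; apply: mean_avoid_ends.
  - exact: add_edges_sym.
  - exact: leq_trans L1 (longest_sub (@sub_add_edges _ e _)).
  - by apply: expanding_sub ex; exact: sub_add_edges.
by rewrite sumr_const card_tuple card_option card_prod card_ord [leRHS]mulr_natl.
Qed.

Lemma poly_expR_le T : exists C : R, forall n, (0 < n)%N ->
  ((n * n).+1 ^ T)%:R * expR (- (n%:R / 128)) <= C / n%:R.
Proof.
pose k := (2 * T)%N; exists (2 ^+ T * (128 ^+ k.+1 * k.+1`!%:R)) => n n0.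
have nR : (0 : R) < n%:R by rewrite ltr0n.
have fR : (0 : R) < k.+1`!%:R by rewrite ltr0n fact_gt0.
rewrite expRN -/(_ / _) ler_pdivrMr ?expR_gt0 //.
have le1 : ((n * n).+1 ^ T)%:R <= 2 ^+ T * n%:R ^+ k :> R.
  by rewrite /k exprM -exprMn natrX lerXn2r ?nnegrE ?mulr_ge0 ?exprn_ge0 ?ler0n //
    -natrX -natrM ler_nat; nia.
apply: le_trans le1 _; rewrite -!mulrA ler_wpM2l ?exprn_ge0 //.
have := expR_ge1Dxn k (divr_ge0 (ltW nR) (ler0n R 128)).
have : 0 < n%:R ^+ k.+1 / 128 ^+ k.+1 / k.+1`!%:R :> R.
  by rewrite !divr_gt0 ?exprn_gt0.
rewrite expr_div_n; set E := expR _; move=> _ le.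
have {le} : n%:R ^+ k.+1 / 128 ^+ k.+1 / k.+1`!%:R <= E by lra.
move=> le; have := le; rewrite !ler_pdivrMr ?exprn_gt0 // => {}le.
have -> : 128 ^+ k.+1 * (k.+1`!%:R * (n%:R^-1 * E)) =
    E * k.+1`!%:R * 128 ^+ k.+1 / n%:R by ring.
by rewrite ler_pdivlMr // -exprSr.
Qed.

Lemma pow32_large x : exists T, x < (3 / 2) ^+ T :> R.
Proof.
have ge T : T%:R / 2 <= (3 / 2) ^+ T :> R.
  elim: T => [|T IHT]; first by rewrite mul0r.
  have z1 : 1 <= (3 / 2) ^+ T :> R by apply: exprn_ege1; lra.
  by rewrite exprS -natr1; lra.
exists (Num.truncn (2 * x)).+1; apply: lt_le_trans (ge _).
by rewrite ltr_pdivlMr // mulrC truncnS_gt.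
Qed.

(** The three terms account for a failure of expansion, for a deficit larger than [T]
    (by Markov's inequality), and for a failure of the sprinkling. *)
Lemma mean_not_hamiltonian M T m : (0 < M <= m)%N -> (T + 3 <= m.+1)%N ->
  mean (hists 13 m) (fun h => (`[< ~ hamiltonian (@hist_graph m.+1 h) >])%:R)
  <= 64 / M%:R + ((3 / 2) ^+ M.+1 + 75 / 2) / (3 / 2) ^+ T +
     ((m.+1 * m.+1).+1 ^ T)%:R * expR (- (m.+1%:R / 128)) :> R.
Proof.
move=> Mm Tm; set Q := (_ * expR _); have /andP[M0 Mlem] := Mm.
have zT : 0 < (3 / 2) ^+ T :> R by rewrite exprn_gt0 //; lra.
have Q0 : 0 <= Q by rewrite mulr_ge0 ?ler0n ?expR_ge0.
have W0 h : 0 <= steady_weight R m.+1 M m h.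
  by rewrite mulr_ge0 ?ler0n ?exprn_ge0 //; lra.
rewrite mean_merge; apply: le_trans (_ : mean (hists 12 m) (fun h =>
   (`[< ~ steady m.+1 M h >])%:R + steady_weight R m.+1 M m h / (3 / 2) ^+ T + Q) <= _).
  apply: ler_mean => h hm; have hs : size h = m by have /mem_hists[] := hm.
  have le1 : mean (hists 1 m) (fun g =>
      (`[< ~ hamiltonian (@hist_graph m.+1 (merge_hist g h)) >])%:R) <= 1 :> R.
    rewrite -[leRHS](mean_cst 1 (hists_gt0 1 m)); apply: ler_mean => g _.
    by rewrite lern1 leq_b1.
  have WT0 : 0 <= steady_weight R m.+1 M m h / (3 / 2) ^+ T by rewrite divr_ge0 // ltW.
  have [st|nst] := pselect (steady m.+1 M h); last first.
    apply: le_trans le1 _; rewrite (asboolT nst) mulr1n; lra.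
  have [DT|TD] := leqP (deficit m.+1 m h) T.
    apply: le_trans (mean_sprinkle hm _ _ DT Tm) _; last by rewrite -/Q; have := ler0n R `[< ~ steady m.+1 M h >]; lra.
      exact: leq_trans M0 Mlem.
    by rewrite -first_vertices_all; have := steady_expanding st; rewrite hs; apply.
  apply: le_trans le1 _; suff : 1 <= steady_weight R m.+1 M m h / (3 / 2) ^+ T.
    by have := ler0n R `[< ~ steady m.+1 M h >]; lra.
  rewrite ler_pdivlMr // mul1r /steady_weight (asboolT st) mul1r.
  by rewrite ler_pow32 // ltnW.
rewrite !meanD meanZr mean_cst ?hists_gt0 // lerD2r lerD //.
  apply: le_trans (mean_not_steady R Mm (ltnSn m)) _.
  by rewrite lerBlDr lerDl divr_ge0 ?ler0n.
by rewrite ler_pM2r ?invr_gt0 // mean_steady_weight.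
Qed.

End Final.

Local Open Scope classical_set_scope.
Local Open Scope ring_scope.

Theorem theorem2p3 (R : realType) :
  (fun n : nat => ua_prob R 13 (@hamiltonian 'I_n)) @ \oo --> (1 : R).
Proof.
apply/cvgrPdist_lt => eps eps0.
pose M := (Num.truncn (64 * 3 / eps)).+1.
have MR : (0 : R) < M%:R by rewrite ltr0n.
have Me : 64 / M%:R < eps / 3.
  have : 64 * 3 / eps < M%:R by exact: truncnS_gt.
  by rewrite ltr_pdivrMr // ltr_pdivrMr // => le; lra.
pose K : R := (3 / 2) ^+ M.+1 + 75 / 2.
have [T KT] := pow32_large (K * 3 / eps).
have zT : 0 < (3 / 2) ^+ T :> R by rewrite exprn_gt0 //; lra.
have Te : K / (3 / 2) ^+ T < eps / 3.
  by move: KT; rewrite ltr_pdivrMr // ltr_pdivrMr // => le; lra.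
have [C CP] := poly_expR_le R T.
suff main n : (M + T + 3 < n)%N -> C * 3 / eps < n%:R ->
    `|1 - ua_prob R 13 (@hamiltonian 'I_n)| < eps.
  near=> n; apply: main; near: n; [exact: nbhs_infty_gt | exact: nbhs_infty_gtr].
move=> nM nC; have nR : (0 : R) < n%:R by rewrite ltr0n; lia.
have Qe : ((n * n).+1 ^ T)%:R * expR (- (n%:R / 128)) < eps / 3.
  apply: le_lt_trans (CP n _) _; first lia.
  by move: nC; rewrite ltr_pdivrMr // ltr_pdivrMr // => le; lra.
rewrite ua_probE; case: n nM nC nR Qe => // m nM _ _ Qe; rewrite -[m.+1.-1]/m.
have := @mean_not_hamiltonian R M T m; rewrite -/K.
set bad := mean _ _; set good := mean _ _ => bad_le.
have -> : 1 - good = bad.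
  rewrite -(mean_cst 1 (hists_gt0 13 m)) -meanB; apply: eq_mean => h _.
  by rewrite asbool_neg; case: asboolP => _; rewrite ?subrr ?subr0.
have bad0 : 0 <= bad by apply: mean_ge0 => h _; rewrite ler0n.
rewrite ger0_norm //; apply: le_lt_trans (bad_le _ _) _; [lia | lia | lra].
Unshelve. all: by end_near.
Qed.
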